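(* Max Lin AA is in the parameterized complexity class W[P].
   Context: Max Lin AA: the input is a system $Az=b$ of $m$ linear equations over $\mathbb{F}_2$ in $n$ variables, each equation with a positive integer weight, and a parameter $k$; the question is whether the maximum excess (total weight of satisfied equations minus total weight of falsified equations, maximized over assignments) is at least $k$. W[P] is the class of parameterized problems whose instances $(x,k)$ can be decided in time $f(k)|x|^{O(1)}$ by a nondeterministic Turing machine making at most $f(k)\log|x|$ nondeterministic steps, for some computable function $f$.
   Formalization: Every equation is required to have a nonzero left-hand side (so the average excess is 0); if equations 0=1 were allowed, the problem would be NP-hard already for k=0 and membership in W[P] would imply P=NP. *)

(* Defs.v *)
From HB Require Import structures.
From mathcomp Require Import all_boot all_order all_algebra.

Set Implicit Arguments.
Unset Strict Implicit.
Unset Printing Implicit Defensive.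

Import GRing.Theory Num.Theory.

(** * Nondeterministic multitape Turing machines *)

Inductive move := MoveLeft | Stay | MoveRight.

Definition option_bool_of_move d : option bool :=
  match d with
  | MoveLeft => Some false | Stay => None | MoveRight => Some true
  end.

Definition move_of_option_bool o : move :=
  match o with
  | Some false => MoveLeft | None => Stay | Some true => MoveRight
  end.

Lemma option_bool_of_moveK : cancel option_bool_of_move move_of_option_bool.
Proof. by case. Qed.

HB.instance Definition _ := Finite.copy move (can_type option_bool_of_moveK).

(** The tape symbols are [None] (the blank), [Some (inl a)] for an input letter
    [a], and [Some (inr b)] for an auxiliary letter [b]. The machine has
    [aux_tapes.+1] tapes, tape [ord0] being the input tape. The finite set
    [trans q s] lists the moves available in state [q] when the scanned symbols
    are [s]; the machine halts when there is none. *)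
Record ntm (Sigma : finType) := NTM {
  state : finType;
  aux : finType;
  aux_tapes : nat;
  start : state;
  accepting : {set state};
  trans : state -> {ffun 'I_aux_tapes.+1 -> option (Sigma + aux)} ->
    {set state * {ffun 'I_aux_tapes.+1 -> option (Sigma + aux) * move}}
}.

(** [(l, a, r)] is a two-way infinite tape with scanned symbol [a]; [l] and [r]
    are read away from the head and are followed by blanks. *)
Definition tape (G : Type) : Type := (seq (option G) * option G * seq (option G))%type.

Definition tape_of_word (G : Type) (w : seq (option G)) : tape G :=
  ([::], head None w, behead w).

(** Contents of a tape from the head up to the first blank on its right. *)
Definition word_of_tape (G : eqType) (t : tape G) : seq (option G) :=
  let s := t.1.2 :: t.2 in take (index None s) s.

Definition update_tape (G : Type) (t : tape G) (a : option G * move) : tape G :=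
  let: (l, _, r) := t in
  match a.2 with
  | MoveLeft => (behead l, head None l, a.1 :: r)
  | Stay => (l, a.1, r)
  | MoveRight => (a.1 :: l, head None r, behead r)
  end.

Section Runs.
Variables (Sigma : finType) (M : ntm Sigma).

Definition config : Type :=
  (state M * {ffun 'I_(aux_tapes M).+1 -> tape (Sigma + aux M)})%type.

Definition initial (w : seq Sigma) : config :=
  (start M,
   [ffun i => tape_of_word (if i == ord0 then [seq Some (inl a) | a <- w]
                            else [::])]).

Definition available (c : config) := trans c.1 [ffun i => (c.2 i).1.2].

Definition step (c c' : config) : bool :=
  [exists a in available c,
     c' == (a.1, [ffun i => update_tape (c.2 i) (a.2 i)])].

Definition halted (c : config) : bool := available c == set0.

Definition nondeterministic (c : config) : bool := 1 < #|available c|.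

(** [run w cs]: starting on input [w], the machine can pass successively through
    the configurations [cs], the initial one being left out; the run need not be
    maximal, and it has [size cs] steps. *)
Definition run (w : seq Sigma) (cs : seq config) : bool :=
  path step (initial w) cs.

Definition nondeterministic_steps (w : seq Sigma) (cs : seq config) : nat :=
  count nondeterministic (belast (initial w) cs).

Definition accepts (w : seq Sigma) : Prop :=
  exists2 cs, run w cs
    & halted (last (initial w) cs) && ((last (initial w) cs).1 \in accepting M).

Definition deterministic : Prop := forall q s, #|@trans _ M q s| <= 1.

End Runs.

(** Turing computability, numbers being written in unary. *)
Definition computable (f : nat -> nat) : Prop :=
  exists2 M : ntm unit, deterministic M
    & forall k, exists cs : seq (config M),
        [/\ run (nseq k tt) cs,
            halted (last (initial M (nseq k tt)) cs)
          & word_of_tape ((last (initial M (nseq k tt)) cs).2 ord0)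
            = nseq (f k) (Some (inl tt))].

(** * The class W[P] *)

Definition parameterized_problem (Sigma : Type) : Type :=
  seq Sigma -> nat -> Prop.

(** [(x, k)] is presented to a machine as [x] followed by [k] copies of a fresh
    letter, here [None : option Sigma]. *)
Definition instance_word (Sigma : Type) (x : seq Sigma) (k : nat) :
  seq (option Sigma) := [seq Some a | a <- x] ++ nseq k None.

(** The time bound f(k) |x|^O(1) is written with [(size x).+1] so that it does not
    degenerate for [size x <= 1]. The bounds are required of all runs, so that
    every run terminates. *)
Definition W_P (Sigma : finType) (L : parameterized_problem Sigma) : Prop :=
  exists (M : ntm (option Sigma)) (f : nat -> nat) (c : nat),
    computable f /\
    forall (x : seq Sigma) (k : nat),
      (forall cs : seq (config M), run (instance_word x k) cs ->
         size cs <= f k * (size x).+1 ^ c /\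
         nondeterministic_steps (instance_word x k) cs
           <= f k * trunc_log 2 (size x)) /\
      (accepts M (instance_word x k) <-> L x k).

(** * Max Lin AA *)

Local Open Scope ring_scope.

(** Every left-hand side is nonzero, as is implicit in the parameterization above
    average: exactly then is each equation satisfied by half of the assignments,
    so that the average excess is 0. *)
Record lin_system := LinSystem {
  equations : nat;
  variables : nat;
  lhs : 'M['F_2]_(equations, variables);
  rhs : 'cV['F_2]_equations;
  weight : 'I_equations -> nat;
  weight_gt0 : forall j, (0 < weight j)%N;
  lhs_neq0 : forall j, row j lhs != 0
}.

Definition satisfies (S : lin_system) (z : 'cV['F_2]_(variables S))
  (j : 'I_(equations S)) : bool := (lhs S *m z) j 0 == rhs S j 0.

Definition excess (S : lin_system) (z : 'cV['F_2]_(variables S)) : int :=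
  \sum_(j | satisfies z j) (weight j)%:Z
  - \sum_(j | ~~ satisfies z j) (weight j)%:Z.

Definition max_excess (S : lin_system) : int :=
  \big[Num.max/@excess S 0]_(z : 'cV['F_2]_(variables S)) excess z.

(** Binary expansion of [n > 0], least significant bit first. *)
Definition binary (n : nat) : seq bool :=
  mkseq (fun i => odd (n %/ 2 ^ i)) (trunc_log 2 n).+1.

(** Instances are words over [option bool], where [None] is a separator: the
    number of variables in unary, then for each equation its coefficients, its
    right-hand side and its weight in binary. *)
Definition encode_equation (S : lin_system) (j : 'I_(equations S)) :
  seq (option bool) :=
  [seq Some (lhs S j i == 1) | i <- enum 'I_(variables S)] ++ [:: None] ++
  [:: Some (rhs S j 0 == 1); None] ++
  [seq Some a | a <- binary (weight j)] ++ [:: None].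

Definition encode (S : lin_system) : seq (option bool) :=
  nseq (variables S) (Some true) ++ [:: None] ++
  flatten [seq encode_equation j | j <- enum 'I_(equations S)].

(** Words that encode no system are no-instances. *)
Definition MaxLinAA : parameterized_problem (option bool) :=
  fun x k => exists2 S : lin_system, x = encode S & k%:Z <= max_excess S.

(* Main.v *)
(** The average excess over an affine subspace given by some equations is the
    signed weight of the equations whose left-hand side lies in the span of theirs.
    Fix an assignment [z] of excess at least [k] and equations satisfied by [z] whose
    average is below [k]. Grouping the other equations by left-hand side modulo the
    span, some group has positive total signed weight at [z], so it contains an
    equation satisfied by [z]; adding it raises the average by at least 1. So [k]
    choices of an equation suffice, each guessed with log m + 1 binary choices and
    followed by an elimination step; the average is then read off the equations that
    have become trivial. *)

From mathcomp Require Import all_boot all_order all_algebra zify.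
Require Import Defs.

Set Implicit Arguments.
Unset Strict Implicit.
Unset Printing Implicit Defensive.

Import Order.TTheory GRing.Theory Num.Theory.

(** * Stack programs *)

(** The class asks for one concrete machine with bounds on all of its runs. The machine is compiled
    from a small language of stack programs whose only branching instruction is a binary choice. A
    stream of bits resolves the choices, so that result, running time and number of choices are
    established for a deterministic execution under every stream and then carried over to all runs
    at once. Soundness asks nothing of the guessed equations: some assignment of the reduced system
    does at least as well as its average, by conditional expectations, and it is pulled back through
    the eliminations. A bad guess can therefore cause a loss but never a false acceptance. The index
    m, just beyond the last of the m equations, is an idle guess; it allows exactly k rounds
    whatever the number of useful ones. For m > 0 a guess costs log m + 1 = log (2m) choices, and an
    encoding of m equations has at least 2m symbols, so k guesses stay within k log |x|. *)

Notation sym := (option (option bool)).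
Notation bit b := (Some (Some b) : sym).
Notation sep := (Some None : sym).
Notation par := (None : sym).

Definition naux := 11.

(** A choice is binary, so each branching costs one bit of the stream, and nondeterministic steps
    are bounded by counting consumed bits. *)
Inductive instr (X : Type) :=
  | Act of nat & option sym -> (option sym * move) * X
  | Choose of X & X
  | Stop.
Arguments Stop {X}.

Definition imap X Y (h : X -> Y) (c : instr X) : instr Y :=
  match c with
  | Act i f => Act i (fun o => ((f o).1, h (f o).2))
  | Choose x y => Choose (h x) (h y)
  | Stop => Stop
  end.

(** A label [None] is the exit of the program; [Stop] is a rejecting halt. *)
Record prog := Prog {
  label : finType;
  entry : label;
  code : label -> instr (option label)
}.

(** The auxiliary alphabet is empty: bits, separators and parameter letters suffice for all work
    stacks. *)
Notation letter := (sym + void)%type.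
Notation tapes := {ffun 'I_naux.+1 -> tape letter}.

Definition of_letter (a : option letter) : option sym :=
  if a is Some (inl g) then Some g else None.
Definition to_letter (o : option sym) : option letter := omap inl o.

Lemma of_letterK : cancel of_letter to_letter.
Proof. by case=> [[g|[]]|]. Qed.

Definition scan (tp : tapes) : {ffun 'I_naux.+1 -> option letter} :=
  [ffun i => (tp i).1.2].

Definition writing (s : {ffun 'I_naux.+1 -> option letter}) (i : nat)
    (a : option sym * move) : {ffun 'I_naux.+1 -> option letter * move} :=
  [ffun j => if j == inord i then (to_letter a.1, a.2) else (s j, Stay)].

Definition update (tp : tapes) (a : {ffun 'I_naux.+1 -> option letter * move}) :
  tapes := [ffun i => update_tape (tp i) (a i)].

Definition act i (f : option sym -> option sym * move) : prog :=
  @Prog unit tt (fun _ => Act i (fun o => (f o, None))).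

Definition fail : prog := @Prog unit tt (fun _ => Stop).

Definition seqp (M1 M2 : prog) : prog :=
  @Prog (label M1 + label M2)%type (inl (entry M1)) (fun s =>
    match s with
    | inl s => imap (fun o => if o is Some s' then Some (inl s') else Some (inr (entry M2))) (code s)
    | inr s => imap (omap inr) (code s)
    end).

(** The scanned symbol stays in place; it is remembered in the control state, as the tag in the
    disjoint union of the branches. *)
Definition sw i (F : option sym -> prog) : prog :=
  @Prog (option {o : option sym & label (F o)}) None (fun s =>
    match s with
    | None => Act i (fun o => (o, Stay, Some (Some (Tagged (fun o => label (F o)) (entry (F o))))))
    | Some (existT o s) => imap (omap (fun s' => Some (Tagged (fun o => label (F o)) s'))) (code s)
    end).

Definition loop i (t : pred (option sym)) (M : prog) : prog :=
  @Prog (option (label M)) None (fun s =>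
    match s with
    | None => Act i (fun o => (o, Stay, if t o then Some (Some (entry M)) else None))
    | Some s => imap (fun o => if o is Some s' then Some (Some s') else Some None) (code s)
    end).

Definition choice (M1 M2 : prog) : prog :=
  @Prog (option (label M1 + label M2)) None (fun s =>
    match s with
    | None => Choose (Some (Some (inl (entry M1)))) (Some (Some (inr (entry M2))))
    | Some (inl s) => imap (omap (fun s' => Some (inl s'))) (code s)
    | Some (inr s) => imap (omap (fun s' => Some (inr s'))) (code s)
    end).

Notation "p ;; q" := (seqp p q) (at level 60, right associativity).
Definition skip := act 0 (fun o => (o, Stay)).
Definition pop i := act i (fun _ => (None, MoveRight)).
(** The cell reached on the left may hold anything; the second step overwrites it. *)
Definition push i g := act i (fun o => (o, MoveLeft)) ;; act i (fun _ => (Some g, Stay)).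

(** * Execution under a stream of choices, with rules for results and step counts *)

Section Semantics.
Variable bs : nat -> bool.

Definition next (M : prog) (x : option (label M) * tapes * nat) :
    option (option (label M) * tapes * nat) :=
  let: (q, tp, c) := x in
  if q is Some s then
    match code s with
    | Act i f => let y := f (of_letter (scan tp (inord i))) in
                 Some (y.2, update tp (writing (scan tp) i y.1), c)
    | Choose q1 q2 => Some (if bs c then q1 else q2, tp, c.+1)
    | Stop => None
    end
  else None.

Fixpoint nsteps (M : prog) n (x : option (label M) * tapes * nat) :=
  if n is n'.+1 then obind (@nsteps M n') (next x) else Some x.

Lemma nstepsS (M : prog) n (x : option (label M) * tapes * nat) :
  nsteps n.+1 x = obind (@nsteps M n) (next x).
Proof. by []. Qed.

Lemma nstepsD (M : prog) m n (x : option (label M) * tapes * nat) :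
  nsteps (m + n) x = obind (nsteps n) (nsteps m x).
Proof. by elim: m x => //= m IH x; case: (next x) => //= y; rewrite IH. Qed.

(** Labels of [M1] are renamed by [g] and its exit is redirected to [e]. Nothing is executed after
    an exit, so an exit can only be reached by the last of the [n] steps; hence step counts and
    consumed choices agree. *)
Lemma nsteps_embed (M1 M : prog) (g : label M1 -> label M) (e : option (label M)) :
  let h o := if o is Some s then Some (g s) else e in
  (forall s, code (g s) = imap h (code s)) ->
  forall n s tp c q tp' c', nsteps n (Some s, tp, c) = Some (q, tp', c') ->
  nsteps n (Some (g s), tp, c) = Some (h q, tp', c').
Proof.
move=> h codeE; elim=> [|n IH] s tp c q tp' c' /=; first by case=> <- <- <-.
have exit_step tp1 c1 : nsteps n (None, tp1, c1) = Some (q, tp', c') ->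
    nsteps n (e, tp1, c1) = Some (h q, tp', c').
  by case: n {IH} => //= -[<- <- <-].
rewrite codeE; case: (code s) => [i f|q1 q2|] //=.
  by case: (f _).2 => [s1|] /=; [exact: IH|exact: exit_step].
have -> : (if bs c then h q1 else h q2) = h (if bs c then q1 else q2) by case: (bs c).
by case: (if bs c then q1 else q2) => [s1|]; [exact: IH|exact: exit_step].
Qed.

(** The head is on the top of the stack, which extends to the right; what lies to
    the left of the head is irrelevant. *)
Definition represents (t : tape letter) (s : seq sym) : Prop :=
  forall n, nth None (t.1.2 :: t.2) n = nth None [seq to_letter (Some g) | g <- s] n.

Definition holds (tp : tapes) (s : seq (seq sym)) : Prop :=
  forall i : 'I_naux.+1, represents (tp i) (nth [::] s i).

Definition get (s : seq (seq sym)) i := nth [::] s i.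
Definition set (s : seq (seq sym)) i x := set_nth [::] s i x.

(** Started with stacks [s] and [c] consumed choices, [M] ends within [T] steps with
    [c'] consumed choices, rejecting if [o] is [None]. *)
Definition spec (M : prog) c s c' (o : option (seq (seq sym))) T : Prop :=
  forall tp, holds tp s -> exists n tp', n <= T /\
    if o is Some s' then nsteps n (Some (entry M), tp, c) = Some (None, tp', c') /\ holds tp' s'
    else exists q, nsteps n (Some (entry M), tp, c) = Some (Some q, tp', c') /\ code q = Stop.

Lemma spec_le M c s c' o T T' : spec M c s c' o T -> T <= T' -> spec M c s c' o T'.
Proof.
move=> sp le tp /sp[n [tp' [len h]]]; exists n, tp'; split => //.
exact: leq_trans le.
Qed.

Lemma scan_holds tp s i : i <= naux -> holds tp s ->
  of_letter (scan tp (inord i)) = ohead (get s i).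
Proof.
move=> lei /(_ (inord i)) /(_ 0); rewrite ffunE /= inordK // => ->.
by rewrite /get; case: (nth [::] s i).
Qed.

Lemma update_other tp i a (j : 'I_naux.+1) : j != inord i ->
  update tp (writing (scan tp) i a) j = tp j.
Proof. by move=> /negPf ne; rewrite !ffunE ne; case: (tp j) => [[]]. Qed.

Lemma holds_update tp s i a x : i <= naux -> holds tp s ->
  represents (update_tape (tp (inord i)) (to_letter a.1, a.2)) x ->
  holds (update tp (writing (scan tp) i a)) (set s i x).
Proof.
move=> lei h r j; rewrite nth_set_nth /=; case: (eqVneq j (inord i)) => [->|ne].
  by rewrite inordK // eqxx !ffunE eqxx.
rewrite update_other //; case: eqP => [ji|_]; last exact: h.
by case/eqP: ne; apply: val_inj; rewrite /= inordK.
Qed.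

Lemma nsteps_act i f tp c :
  nsteps 1 (Some (entry (act i f)), tp, c) =
  Some (None, update tp (writing (scan tp) i (f (of_letter (scan tp (inord i))))), c).
Proof. by []. Qed.

Lemma spec_act i f x s c : i <= naux ->
  (forall t, represents t (get s i) ->
     represents (update_tape t (to_letter (f (ohead (get s i))).1, (f (ohead (get s i))).2)) x) ->
  spec (act i f) c s c (Some (set s i x)) 1.
Proof.
move=> lei h tp r; exists 1, (update tp (writing (scan tp) i (f (of_letter (scan tp (inord i)))))).
split=> //; split; first exact: nsteps_act.
by apply: holds_update => //; rewrite (scan_holds lei r); apply: h; have := r (inord i); rewrite inordK.
Qed.

Lemma spec_fail c s : spec fail c s c None 0.
Proof. by move=> tp _; exists 0, tp; split=> //; exists tt. Qed.

Lemma update_stay tp i (a := of_letter (scan tp (inord i))) :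
  update tp (writing (scan tp) i (a, Stay)) = tp.
Proof.
apply/ffunP=> j; case: (eqVneq j (inord i)) => [->|]; last exact: update_other.
by rewrite /a !ffunE eqxx of_letterK; case: (tp _) => [[]].
Qed.

Lemma spec_skip c s : spec skip c s c (Some s) 1.
Proof.
move=> tp r; exists 1, tp; split=> //; split => //.
by rewrite nsteps_act update_stay.
Qed.

Lemma spec_pop i c s : i <= naux -> spec (pop i) c s c (Some (set s i (behead (get s i)))) 1.
Proof.
move=> lei; apply: spec_act => // -[[l a] r] h n /=.
have := h n.+1; rewrite /= (_ : nth _ (head _ _ :: _) n = nth None r n); last by case: r n {h} => [[|[]]|? ? []].
by move=> ->; case: get => //=; case: n.
Qed.

Lemma spec_seq M1 M2 c s c1 s1 c2 o T1 T2 :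
  spec M1 c s c1 (Some s1) T1 -> spec M2 c1 s1 c2 o T2 -> spec (M1 ;; M2) c s c2 o (T1 + T2).
Proof.
move=> sp1 sp2 tp /sp1 [n1 [tp1 [le1 [run1 h1]]]]; have [n2 [tp2 [le2 run2]]] := sp2 _ h1.
exists (n1 + n2), tp2; split; first exact: leq_add.
have E1 : nsteps n1 (Some (entry (M1 ;; M2)), tp, c) = Some (Some (inr (entry M2)), tp1, c1).
  by rewrite (@nsteps_embed M1 (M1 ;; M2) inl (Some (inr (entry M2))) (fun t => erefl) _ _ _ _ _ _ _ run1).
rewrite nstepsD E1 [obind _ _]/=.
have emb := @nsteps_embed M2 (M1 ;; M2) inr None (fun t => erefl).
case: o run2 {sp2} => [s2|] [].
  by move=> run2 h2; rewrite (emb _ _ _ _ _ _ _ run2).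
by move=> q [run2 stop]; exists (inr q); rewrite (emb _ _ _ _ _ _ _ run2) /= stop.
Qed.

Lemma spec_seq_fail M1 M2 c s c1 T1 :
  spec M1 c s c1 None T1 -> spec (M1 ;; M2) c s c1 None T1.
Proof.
move=> sp1 tp /sp1 [n1 [tp1 [le1 [q [run1 stop]]]]].
exists n1, tp1; split=> //; exists (inl q); split; last by rewrite /= stop.
by rewrite (@nsteps_embed M1 (M1 ;; M2) inl (Some (inr (entry M2))) (fun t => erefl) _ _ _ _ _ _ _ run1).
Qed.

(** Common form of [sw] and [choice]: one initial step enters an embedded copy of [M1], whose exit
    is also the exit of the whole program. *)
Lemma spec_jump M1 M (g : label M1 -> label M) c c1 s c2 o T :
    (forall s, code (g s) = imap (omap g) (code s)) ->
    (forall tp, holds tp s -> next (Some (entry M), tp, c) = Some (Some (g (entry M1)), tp, c1)) ->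
  spec M1 c1 s c2 o T -> spec M c s c2 o T.+1.
Proof.
move=> codeE first sp tp h; have [n [tp2 [le run]]] := sp _ h.
exists n.+1, tp2; split=> //; rewrite nstepsS (first _ h) [obind _ _]/=.
have emb := @nsteps_embed M1 M g None codeE.
case: o run {sp} => [s2|] [].
  by move=> run2 h2; rewrite (emb _ _ _ _ _ _ _ run2).
move=> q [run2 stop]; exists (g q); rewrite (emb _ _ _ _ _ _ _ run2) /=.
by rewrite codeE stop.
Qed.

Lemma spec_sw i F c s c' o T : i <= naux ->
  spec (F (ohead (get s i))) c s c' o T -> spec (sw i F) c s c' o T.+1.
Proof.
move=> lei; set a := ohead _.
apply: (@spec_jump (F a) (sw i F) (fun t => Some (Tagged (fun o => label (F o)) t))) => //.
by move=> tp h /=; rewrite (update_stay tp i) (scan_holds lei h).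
Qed.

Lemma spec_choice M1 M2 c s c' o T :
  spec (if bs c then M1 else M2) c.+1 s c' o T -> spec (choice M1 M2) c s c' o T.+1.
Proof.
case: ifP => bsc.
  apply: (@spec_jump M1 (choice M1 M2) (fun t => Some (inl t))) => //.
  by move=> tp h /=; rewrite bsc.
apply: (@spec_jump M2 (choice M1 M2) (fun t => Some (inr t))) => //.
by move=> tp h /=; rewrite bsc.
Qed.

Lemma spec_loop_exit i (t : pred (option sym)) M c s : i <= naux -> ~~ t (ohead (get s i)) ->
  spec (loop i t M) c s c (Some s) 1.
Proof.
move=> lei /negPf stop tp h; exists 1, tp; split=> //; split=> //=.
by rewrite (update_stay tp i) (scan_holds lei h) stop.
Qed.

Lemma next_loop i (t : pred (option sym)) M tp c s : i <= naux -> t (ohead (get s i)) -> holds tp s ->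
  next (Some (entry (loop i t M)), tp, c) = Some (Some (Some (entry M)), tp, c).
Proof. by move=> lei ts h /=; rewrite (update_stay tp i) (scan_holds lei h) ts. Qed.

Lemma spec_loop_step i (t : pred (option sym)) M c s c1 s1 c2 o T1 T2 : i <= naux -> t (ohead (get s i)) ->
  spec M c s c1 (Some s1) T1 -> spec (loop i t M) c1 s1 c2 o T2 ->
  spec (loop i t M) c s c2 o (T1 + T2).+1.
Proof.
move=> lei ts sp1 sp2 tp h; have [n1 [tp1 [le1 [run1 h1]]]] := sp1 _ h.
have [n2 [tp2 [le2 run2]]] := sp2 _ h1.
exists (n1 + n2).+1, tp2; split; first by rewrite ltnS leq_add.
have -> : nsteps (n1 + n2).+1 (Some (entry (loop i t M)), tp, c) =
    nsteps n2 (Some (entry (loop i t M)), tp1, c1); last by [].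
rewrite -addSn nstepsD nstepsS (next_loop _ _ lei ts h) [obind _ _]/=.
by rewrite (@nsteps_embed M (loop i t M) (fun t => Some t) (Some None) (fun t => erefl) _ _ _ _ _ _ _ run1).
Qed.

Lemma spec_loop_fail i (t : pred (option sym)) M c s c1 T1 : i <= naux -> t (ohead (get s i)) ->
  spec M c s c1 None T1 -> spec (loop i t M) c s c1 None T1.+1.
Proof.
move=> lei ts sp1 tp h; have [n1 [tp1 [le1 [q [run1 stop]]]]] := sp1 _ h.
exists n1.+1, tp1; split=> //; exists (Some q); split; last by rewrite /= stop.
rewrite nstepsS (next_loop _ _ lei ts h) [obind _ _]/=.
by rewrite (@nsteps_embed M (loop i t M) (fun t => Some t) (Some None) (fun t => erefl) _ _ _ _ _ _ _ run1).
Qed.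

Lemma spec_push i g c s : i <= naux -> spec (push i g) c s c (Some (set s i (g :: get s i))) 2.
Proof.
move=> lei tp h; pose tp1 := update tp (writing (scan tp) i (of_letter (scan tp (inord i)), MoveLeft)).
pose tp2 := update tp1 (writing (scan tp1) i (Some g, Stay)).
exists 2, tp2; split=> //; split=> //.
move=> j; rewrite nth_set_nth /=; case: (eqVneq j (inord i)) => [->|ne].
  rewrite inordK // eqxx !ffunE eqxx of_letterK => n.
  have := h (inord i); rewrite inordK //.
  by case: (tp _) => [[l a] r] /= hr; case: n => // n; have := hr n.
rewrite !update_other //; case: eqP => [ji|_]; last exact: h.
by case/eqP: ne; apply: val_inj; rewrite /= inordK.
Qed.

End Semantics.

(** * Programs as Turing machines *)

(** Both the exit and [Stop] halt for want of transitions; only the exit is accepting. *)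
Definition machine (M : prog) : ntm sym :=
  @NTM sym (option (label M)) void naux (Some (entry M)) [set None] (fun q s =>
    if q is Some l then
      match code l with
      | Act i f => let y := f (of_letter (s (inord i))) in [set (y.2, writing s i y.1)]
      | Choose q1 q2 => [set (q1, [ffun i => (s i, Stay)]); (q2, [ffun i => (s i, Stay)])]
      | Stop => set0
      end
    else set0).

Lemma update_none tp : update tp [ffun i => (scan tp i, Stay)] = tp.
Proof. by apply/ffunP=> j; rewrite !ffunE; case: (tp j) => [[]]. Qed.

Lemma stepP (M : prog) (x y : config (machine M)) :
  reflect (exists2 a, a \in available x & y = (a.1, update x.2 a.2)) (step x y).
Proof.
apply: (iffP existsP) => -[a].
  by case/andP=> av /eqP ->; exists a.
by move=> av ->; exists a; rewrite av /=; apply/eqP.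
Qed.

Lemma step_next (M : prog) (x y : config (machine M)) : step x y ->
  (~~ nondeterministic x /\ forall bs n, @next bs M (x, n) = Some (y, n)) \/
  (exists b, forall bs n, bs n = b -> @next bs M (x, n) = Some (y, n.+1)).
Proof.
case/stepP=> a; rewrite /nondeterministic /available; case: x => [[l|] tp] /=; last by rewrite inE.
case E: (code l) => [i f|q1 q2|]; last by rewrite inE.
  rewrite /= inE cards1 => /eqP -> ->; by left; split=> [|bs n].
(* The bit tells whether the first of the two transitions was taken. *)
rewrite !inE => ha ->; right; exists (a == (q1, [ffun i => (scan tp i, Stay)])) => bs n /=.
move=> ->; case: eqP ha => [->|_] /=; first by rewrite update_none.
by move=> /eqP -> /=; rewrite update_none.
Qed.

Lemma next_step (M : prog) bs (x y : config (machine M)) n n' :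
  @next bs M (x, n) = Some (y, n') -> @step _ (machine M) x y.
Proof.
case: x => [[l|] tp] //=; case E: (code l) => [i f|q1 q2|] //= -[<- _]; apply/stepP; rewrite /available /= E.
  by exists ((f (of_letter (scan tp (inord i)))).2, writing (scan tp) i (f (of_letter (scan tp (inord i)))).1); rewrite ?inE.
exists (if bs n then q1 else q2, [ffun i => (scan tp i, Stay)]); last by rewrite update_none.
by rewrite !inE /=; case: (bs n); rewrite eqxx ?orbT.
Qed.

(** A run is replayed from one recorded bit per [Choose]. Only an inequality holds: a [Choose] with
    two equal targets consumes a bit but offers a single transition, so it is not a nondeterministic
    step. *)
Lemma path_nsteps (M : prog) (cs : seq (config (machine M))) x : path (@step _ _) x cs ->
  exists2 bl : seq bool, count (@nondeterministic _ _) (belast x cs) <= size bl &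
    forall bs n, (forall i, i < size bl -> bs (n + i) = nth false bl i) ->
      @nsteps bs M (size cs) (x, n) = Some (last x cs, n + size bl).
Proof.
elim: cs x => [|y cs IH] x; first by move=> _; exists [::] => // bs n _; rewrite addn0.
rewrite [path _ _ _]/= [belast _ _]/= [last _ _]/=; case/andP=> /step_next st /IH [bl le h]; case: st => [[/negPf det nx]|[b nx]].
  by exists bl => [|bs n hb]; [rewrite /= det|rewrite nstepsS nx [obind _ _]/= h].
exists (b :: bl) => [|bs n hb].
  by rewrite -[X in _ <= X]add1n leq_add // leq_b1.
have hb0 : bs n = b by rewrite -[n]addn0 hb.
rewrite nstepsS (nx _ _ hb0) [obind _ _]/=.
by rewrite h ?addSnnS // => i lti; rewrite addSnnS hb.
Qed.

Lemma nsteps_path (M : prog) bs m (x : config (machine M)) n (y : config (machine M)) n' :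
  @nsteps bs M m (x, n) = Some (y, n') ->
  exists2 cs : seq (config (machine M)), path (@step _ _) x cs & last x cs = y.
Proof.
elim: m x n => [|m IH] x n; first by case=> <- _; exists [::].
rewrite nstepsS; case E: (@next bs M (x, n)) => [[z n1]|] //= /IH [cs p l].
by exists (z :: cs) => //=; rewrite (next_step E).
Qed.

(** For a fixed stream execution is deterministic, so a halting execution extends every other one
    from the same start. *)
Lemma nsteps_halt (M : prog) bs n m (x y z : option (label M) * tapes * nat) :
  nsteps bs n x = Some y -> next bs y = None -> nsteps bs m x = Some z ->
  m <= n /\ nsteps bs (n - m) z = Some y.
Proof.
move=> hn stop hm; have lemn : m <= n.
  rewrite leqNgt; apply/negP=> lt; move: hm.
  by rewrite -(subnKC lt) addSnnS nstepsD hn /= stop.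
by split=> //; move: hn; rewrite -{1}(subnKC lemn) nstepsD hm.
Qed.

Lemma next_mono (M : prog) bs (x y : option (label M) * tapes * nat) :
  next bs x = Some y -> x.2 <= y.2.
Proof.
by case: x => [[[l|] tp] n] //=; case: (code l) => [i f|q1 q2|] //= -[<-] /=.
Qed.

Lemma nsteps_mono (M : prog) bs m (x y : option (label M) * tapes * nat) :
  nsteps bs m x = Some y -> x.2 <= y.2.
Proof.
elim: m x => [|m IH] x; first by case=> ->.
by rewrite nstepsS; case E: (next bs x) => [z|] //= /IH; apply: leq_trans; apply: next_mono E.
Qed.

Lemma holds_initial (M : prog) (w : seq sym) :
  holds (initial (machine M) w).2 [:: w].
Proof.
move=> i n; rewrite ffunE; case: eqP => [->|].
  by case: w => [|g w] /=; [case: n => [|[]]|case: n].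
by case: i => -[|i] lti ne; [case: ne; apply: val_inj|rewrite /= nth_nil; case: n => [|[]]].
Qed.

(** Every run, maximal or not, is a prefix of the halting execution under the bits it recorded; the
    bounds for that execution thus hold for all runs. *)
Lemma machine_correct (M : prog) (w : seq sym) T N (A : (nat -> bool) -> bool) :
    (forall bs, exists c s, spec bs M 0 [:: w] c (if A bs then Some s else None) T /\ c <= N) ->
  (forall cs, run (M := machine M) w cs ->
     size cs <= T /\ nondeterministic_steps (M := machine M) w cs <= N) /\
  (accepts (machine M) w <-> exists bs, A bs).
Proof.
move=> total; have h0 := @holds_initial M w.
have follow cs : run (M := machine M) w cs -> exists bs c m z n,
    [/\ c <= N, m <= T, @nsteps bs M m (initial (machine M) w, 0) = Some z, z.2 = c &
      [/\ A bs || isSome z.1.1, next bs z = None,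
        @nsteps bs M (size cs) (initial (machine M) w, 0) = Some (last (initial (machine M) w) cs, n) &
        nondeterministic_steps (M := machine M) w cs <= n]].
  (* Beyond the recorded bits the stream is padded with [false]; any continuation would do, as the
     hypothesis covers all streams. *)
  case/path_nsteps=> bl le h; pose bs := nth false bl.
  have [c [s [sp lec]]] := total bs; have [m [tp [lem out]]] := sp _ h0.
  exists bs, c, m; case: (A bs) out => [[e _]|[q [e stop]]].
    by exists (None, tp, c), (size bl); split=> //; split=> //; rewrite h.
  by exists (Some q, tp, c), (size bl); split=> //; split=> //=; rewrite ?stop ?h.
split=> [cs /follow [bs [c [m [z [n [lec lem hz hz2 [_ stop hcs le]]]]]]]|].
  have [lemn hr] := nsteps_halt hz stop hcs.
  split; first exact: leq_trans lem.
  apply: leq_trans le _; apply: leq_trans lec; rewrite -hz2.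
  exact: (nsteps_mono hr).
split=> [[cs /follow [bs [c [m [z [n [lec lem hz hz2 [acc stop hcs le]]]]]]] /andP [_ hq]]|[bs Abs]].
  exists bs; have [lemn hr] := nsteps_halt hz stop hcs.
  (* The run ends at the exit, where nothing can be executed, so the halting execution ends there as
     well and cannot be a rejecting one. *)
  move: hq hr; rewrite inE => /eqP; case: (last _ _) => _ tp /= ->.
  by case: (m - size cs) => //= -[e]; rewrite -e orbF in acc.
have [c [s []]] := total bs; rewrite Abs => /(_ _ h0) [n [tp [_ [e _]]]] _.
have [cs p l] := nsteps_path e.
by exists cs => //; rewrite l /halted /available inE /= !eqxx.
Qed.

(** The parameter factor of the bounds will be k + 1, since the time bound must stay positive for k
    = 0. In unary, one more letter is written on the left of the input. *)
Definition succ_ntm : ntm unit :=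
  @NTM unit (option bool) void 0 None set0 (fun q s =>
    match q with
    | None => [set (Some false, [ffun i => (s i, MoveLeft)])]
    | Some false => [set (Some true, [ffun=> (Some (inl tt), Stay)])]
    | Some true => set0
    end).

Lemma computable_succ : computable succn.
Proof.
exists succ_ntm => [[[]|] s|k]; rewrite ?cards0 ?cards1 //.
pose t0 := tape_of_word (G := unit + void) [seq Some (inl a) | a <- nseq k tt].
pose c1 : config succ_ntm := (Some false, [ffun=> ([::], None, t0.1.2 :: t0.2)]).
pose c2 : config succ_ntm := (Some true, [ffun=> ([::], Some (inl tt), t0.1.2 :: t0.2)]).
exists [:: c1; c2]; split=> /=.
- rewrite /run /= andbT; apply/andP; split.
    apply/existsP; eexists; apply/andP; split; first by rewrite inE.
    by apply/eqP; congr pair; apply/ffunP=> i; rewrite !ffunE (ord1 i) eqxx.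
  apply/existsP; eexists; apply/andP; split; first by rewrite inE.
  apply/eqP; congr pair; apply/ffunP=> i.
  by rewrite !ffunE.
- by rewrite /halted /available.
- rewrite ffunE /word_of_tape /= /t0; congr cons; case: k {t0 c1 c2} => //= k.
  congr cons; rewrite map_nseq -[RHS](@take_size _ (nseq k _)); set s := nseq k _.
  have notin : None \notin s by rewrite mem_nseq andbF.
  by rewrite memNindex ?take_size.
Qed.

(** * Choosing equations greedily *)

Notation bool_row := (seq bool * bool)%type.

Fixpoint dot (a z : seq bool) : bool :=
  match a, z with x :: a', y :: z' => (x && y) (+) dot a' z' | _, _ => false end.

Definition xorl (a a' : seq bool) := [seq p.1 (+) p.2 | p <- zip a a'].

Definition violated (z : seq bool) (r : bool_row) : bool := dot r.1 z (+) r.2.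

Definition add_row (r r' : bool_row) : bool_row := (xorl r.1 r'.1, r.2 (+) r'.2).

(** Gaussian elimination of the leading variable of [r]; a row [r] with zero
    left-hand side changes nothing. *)
Definition elim_row (r r' : bool_row) : bool_row :=
  if (true \in r.1) && nth false r'.1 (index true r.1) then add_row r r' else r'.

(** A nonzero pivot row is also reduced by itself: it becomes 0 = 0 and contributes its weight to
    the average. For [j] out of range the default row has an empty left-hand side, so nothing
    changes. *)
Definition elim_step (E : seq (bool_row * nat)) (j : nat) : seq (bool_row * nat) :=
  [seq (elim_row (nth ([::], false) (unzip1 E) j) e.1, e.2) | e <- E].

Definition signed (b : bool) (w : nat) : int := if b then (- w%:Z)%R else (w%:Z)%R.

Definition list_excess (z : seq bool) (E : seq (bool_row * nat)) : int :=
  (\sum_(e <- E) signed (violated z e.1) e.2)%R.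

(** The average of [list_excess] over all assignments. *)
Definition average (E : seq (bool_row * nat)) : int :=
  (\sum_(e <- E | true \notin e.1.1) signed e.1.2 e.2)%R.

Definition has_width v (E : seq (bool_row * nat)) := all (fun e => size e.1.1 == v) E.

Lemma dot_zero a z : true \notin a -> dot a z = false.
Proof.
elim: a z => [|x a IH] [|y z] //=; rewrite inE negb_or => /andP [].
by case: x => //= _ /IH ->.
Qed.

Lemma dot_xorl a a' z : size a = size a' -> dot (xorl a a') z = dot a z (+) dot a' z.
Proof.
elim: a a' z => [|x a IH] [|x' a'] [|y z] //= [e]; rewrite IH //.
by case: x x' y (dot a z) (dot a' z) => [] [] [] [] [].
Qed.

Lemma size_xorl a a' : size a = size a' -> size (xorl a a') = size a.
Proof. by move=> e; rewrite size_map size_zip e minnn. Qed.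

Lemma nth_xorl a a' p : size a = size a' ->
  nth false (xorl a a') p = nth false a p (+) nth false a' p.
Proof. by elim: a a' p => [|x a IH] [|x' a'] [|p] //= [/IH]. Qed.

Lemma xorl_zero a a' : size a = size a' -> (true \notin xorl a a') = (a == a').
Proof.
elim: a a' => [|x a IH] [|x' a'] //= [/IH e].
by rewrite inE negb_or e eqseq_cons; case: x x' => [] [].
Qed.

Lemma violated_add z r r' : size r.1 = size r'.1 ->
  violated z (add_row r r') = violated z r (+) violated z r'.
Proof.
by move=> e; rewrite /violated /= dot_xorl // addbACA.
Qed.

Lemma violated_elim z r r' : size r.1 = size r'.1 -> ~~ violated z r ->
  violated z (elim_row r r') = violated z r'.
Proof.
by move=> e /negPf nv; rewrite /elim_row; case: ifP => // _; rewrite violated_add // nv.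
Qed.

Lemma size_elim r r' : size r.1 = size r'.1 -> size (elim_row r r').1 = size r'.1.
Proof. by move=> e; rewrite /elim_row; case: ifP => //= _; rewrite size_xorl. Qed.

Lemma elim_zero r r' : size r.1 = size r'.1 -> true \in r.1 ->
  (true \notin (elim_row r r').1) = (true \notin r'.1) || (r'.1 == r.1).
Proof.
move=> e nz; rewrite /elim_row nz; case: ifP => /= h.
  rewrite xorl_zero // eq_sym; case: eqP => //= _; rewrite ?orbT // orbF.
  by apply/esym/negbTE/negPn; rewrite -h mem_nth // -e index_mem.
by case: eqP h => [->|_ _]; rewrite ?nth_index // orbF.
Qed.

Lemma dot_flip a z p : p < size z -> size a = size z ->
  dot a (set_nth false z p (~~ nth false z p)) = dot a z (+) nth false a p.
Proof.
elim: a z p => [|x a IH] [|y z] [|p] //= lt [e].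
  by case: x y (dot a z) => [] [] [].
by rewrite IH // addbA.
Qed.

Lemma width_elim v E j : has_width v E -> has_width v (elim_step E j).
Proof.
move=> wE; apply/allP=> _ /mapP [e eE ->] /=; have /eqP se := allP wE _ eE.
have [lt|ge] := ltnP j (size (unzip1 E)); last first.
  by rewrite nth_default // /elim_row /= se.
case/mapP: (mem_nth ([::], false) lt) => e' /(allP wE) /eqP se' ->.
by rewrite size_elim ?se ?se'.
Qed.

Lemma width_nth v E j : has_width v E -> j < size E ->
  size (nth ([::], false) (unzip1 E) j).1 = v.
Proof.
move=> wE lt; have lt' : j < size (unzip1 E) by rewrite size_map.
by case/mapP: (mem_nth ([::], false) lt') => e /(allP wE) /eqP se ->.
Qed.

Lemma elim_step_id E j : true \notin (nth ([::], false) (unzip1 E) j).1 -> elim_step E j = E.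
Proof.
move=> /negPf z; rewrite /elim_step -[RHS]map_id; apply: eq_map => -[r w] /=.
by rewrite /elim_row z.
Qed.

(** The leading variable of the pivot no longer occurs after the step, so it can be changed in [z]
    at no cost until the pivot is satisfied. Under such an assignment a reduced row is violated
    exactly when the original one is. *)
Lemma elim_step_sound v E j z : has_width v E -> size z = v ->
  exists2 z', size z' = v & list_excess z' E = list_excess z (elim_step E j).
Proof.
move=> wE sz; set r := nth ([::], false) (unzip1 E) j.
have [nz|z0] := boolP (true \in r.1); last by exists z; rewrite ?elim_step_id.
have lt : j < size E.
  by rewrite ltnNge; apply/negP=> ge; move: nz; rewrite /r nth_default // size_map.
have sr : size r.1 = v by rewrite /r (@width_nth v).
pose p := index true r.1.
have ltp : p < size z by rewrite sz -sr index_mem.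
pose z' := if violated z r then set_nth false z p (~~ nth false z p) else z.
have dz' a : size a = v -> dot a z' = dot a z (+) (violated z r && nth false a p).
  by move=> sa; rewrite /z'; case: ifP; rewrite ?addbF // dot_flip ?sa.
exists z'.
  rewrite /z'; case: ifP => // _; by rewrite size_set_nth (maxn_idPr ltp).
rewrite /list_excess big_map; apply: eq_big_seq => e eE.
have /eqP se := allP wE _ eE.
have satz' : ~~ violated z' r.
  by rewrite /violated dz' // nth_index // andbT addbAC -/(violated z r) addbb.
rewrite -/r -(@violated_elim z' r) ?se //= /violated dz' ?size_elim ?se //.
have -> : nth false (elim_row r e.1).1 p = false.
  rewrite /elim_row nz; case: ifP => //= h.
  by rewrite nth_xorl ?se // nth_index // h.
by rewrite andbF addbF.
Qed.

(** Conditional expectations: the average is the mean of the averages after fixing the first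
    variable to [false] and to [true], so one of the two is at least as large. *)
Lemma average_attained v E : has_width v E ->
  exists2 z, size z = v & (average E <= list_excess z E)%R.
Proof.
elim: v E => [|v IH] E wE.
  exists [::] => //; rewrite /average /list_excess big_mkcond /=.
  rewrite le_eqVlt; apply/orP; left; apply/eqP/eq_big_seq => e /(allP wE) /nilP e0.
  by rewrite e0 /violated e0.
pose sub b := [seq ((behead e.1.1, e.1.2 (+) (b && head false e.1.1)), e.2) | e <- E].
have wsub b : has_width v (sub b).
  apply/allP=> _ /mapP [e eE ->] /=; have /eqP se := allP wE _ eE.
  by rewrite size_behead se.
have exc_sub b z : list_excess (b :: z) E = list_excess z (sub b).
  rewrite /list_excess big_map; apply: eq_big_seq => e eE /=.
  have := allP wE _ eE; case: e {eE} => [[[|x a] r] w] //= _.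
  by congr signed; rewrite /violated /=; case: x b r (dot a z) => [] [] [] [].
have : (average (sub false) + average (sub true) = average E + average E)%R.
  rewrite /average !big_map !(big_mkcond (fun _ => _ \notin _)) -!big_split.
  apply: eq_big_seq => e eE /=.
  have := allP wE _ eE; case: e {eE} => [[[|x a] r] w] //= _.
  (* A row containing the first variable alone becomes trivial in both restrictions, with opposite
     right-hand sides, and its two contributions cancel. *)
  rewrite inE; case: x => /=; case: (true \in a) => /=; rewrite ?addr0 ?addbF //.
  by rewrite addbT /signed; case: r; rewrite /= ?subrr // addNr.
move=> e; have : (average E <= average (sub false) \/ average E <= average (sub true))%R by lia.
case=> le.
  have [z sz le'] := IH _ (wsub false).
  by exists (false :: z); rewrite /= ?sz // exc_sub (le_trans le).
have [z sz le'] := IH _ (wsub true).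
by exists (true :: z); rewrite /= ?sz // exc_sub (le_trans le).
Qed.

Lemma sum_classes (I K : eqType) (s : seq I) (P : pred I) (h : I -> K) (f : I -> int) :
  (0 < \sum_(i <- s | P i) f i)%R ->
  exists2 i, i \in s & P i /\ (0 < \sum_(j <- s | P j && (h j == h i)) f j)%R.
Proof.
move=> pos; pose ks := undup [seq h i | i <- s & P i].
have e : (\sum_(i <- s | P i) f i = \sum_(k <- ks) \sum_(i <- s | P i && (h i == k)) f i)%R.
  rewrite (exchange_big_dep P) /=; last by move=> k i _ /andP [].
  rewrite big_seq_cond [RHS]big_seq_cond; apply: eq_bigr => i /andP [si Pi].
  rewrite Pi (eq_bigl (pred1 (h i))) => [|k]; last by rewrite eq_sym.
  rewrite -big_filter filter_pred1_uniq ?undup_uniq ?big_seq1 // mem_undup.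
  by apply: map_f; rewrite mem_filter Pi.
have [/hasP [k]|/hasPn no] := boolP (has (fun k => (0 < \sum_(i <- s | P i && (h i == k)) f i)%R) ks).
  rewrite mem_undup => /mapP [i]; rewrite mem_filter => /andP [Pi si] -> posk.
  by exists i.
suff : (\sum_(i <- s | P i) f i <= 0)%R by rewrite leNgt pos.
rewrite e big_seq; apply: sumr_le0 => k /no; rewrite -leNgt //.
Qed.

Lemma average_violated z E :
  average E = (\sum_(e <- E | true \notin e.1.1) signed (violated z e.1) e.2)%R.
Proof. by apply: eq_bigr => e z0; rewrite /violated dot_zero. Qed.

Lemma elim_step_excess v E j z : has_width v E -> ~~ violated z (nth ([::], false) (unzip1 E) j) ->
  list_excess z (elim_step E j) = list_excess z E.
Proof.
move=> wE sat; rewrite /list_excess big_map; apply: eq_big_seq => e eE /=.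
have [lt|ge] := ltnP j (size E).
  by rewrite violated_elim // (width_nth wE) //; have /eqP -> := allP wE _ eE.
by rewrite nth_default ?size_map.
Qed.

(** The rows being already reduced, the groups are the nonzero rows with literally equal left-hand
    side. Eliminating with a satisfied member makes exactly its group trivial in addition to the
    rows that were trivial before, and keeps the status of every row at [z]; the average grows by
    the positive signed weight of the group. *)
Lemma elim_step_progress v E z : has_width v E -> (average E < list_excess z E)%R ->
  exists j, [/\ j < size E, ~~ violated z (nth ([::], false) (unzip1 E) j) &
    (average E < average (elim_step E j))%R].
Proof.
move=> wE; rewrite (average_violated z) /list_excess [ltRHS](bigID (fun e => true \notin e.1.1)) /=.
rewrite ltrDl => /(@sum_classes _ _ _ _ (fun e : bool_row * nat => e.1.1)) [e0 e0E [nz pos]].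
have [/hasP [e eE /andP [/eqP ea sat]]|/hasPn no] :=
    boolP (has (fun e => (e.1.1 == e0.1.1) && ~~ violated z e.1) E); last first.
  suff : (\sum_(e <- E | ~~ (true \notin e.1.1) && (e.1.1 == e0.1.1)) signed (violated z e.1) e.2 <= 0)%R.
    by rewrite leNgt pos.
  rewrite big_seq_cond; apply: sumr_le0 => e /andP [/no] /=; rewrite negb_and negbK.
  by case: eqP => _ /= vi; rewrite ?andbF // vi /signed oppr_le0.
rewrite negbK in nz.
exists (index e E); have lt : index e E < size E by rewrite index_mem.
have ne : nth ([::], false) (unzip1 E) (index e E) = e.1.
  by rewrite (nth_map e) // nth_index.
rewrite ne; split=> //.
rewrite (average_violated z (elim_step _ _)) big_map /= ne.
have -> : (\sum_(i <- E | true \notin (elim_row e.1 i.1).1) signed (violated z (elim_row e.1 i.1)) i.2 =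
    \sum_(i <- E | (true \notin i.1.1) || (i.1.1 == e0.1.1)) signed (violated z i.1) i.2)%R.
  rewrite big_seq_cond [RHS]big_seq_cond; apply: eq_big => [i|i /andP [iE _]] /=.
    have [iE|//] := boolP (i \in E).
    have /eqP si := allP wE _ iE; have /eqP se := allP wE _ eE.
    by rewrite /= elim_zero ?ea ?si // -ea se.
  have /eqP si := allP wE _ iE; have /eqP se := allP wE _ eE.
  by rewrite violated_elim // si se.
rewrite [ltRHS](bigID (fun i : bool_row * nat => true \notin i.1.1)) /= [X in (_ < X + _)%R](eq_bigl (fun e : bool_row * nat => true \notin e.1.1)); last first.
  by move=> i; rewrite andbC; case: (true \in _).
rewrite ltrDl (eq_bigl (fun i : bool_row * nat => ~~ (true \notin i.1.1) && (i.1.1 == e0.1.1))) //.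
by move=> i; rewrite andbC; case: (true \in _).
Qed.

(** Here [r] is the number of rounds left. Averages are integers, so a strict increase makes up for
    the round it uses. *)
Lemma elim_steps_complete v E z (k : nat) r : has_width v E ->
  (k%:Z <= list_excess z E)%R -> (k%:Z <= average E + r%:Z)%R ->
  exists js, [/\ size js = r, all (geq (size E)) js & (k%:Z <= average (foldl elim_step E js))%R].
Proof.
elim: r E => [|r IH] E wE ex av; first by exists [::]; split=> //=; lia.
have [le|lt] := lerP (k%:Z)%R (average E).
  have [|js [sj aj kj]] := IH _ wE ex; first lia.
  (* The target is reached already; the round is spent on the idle index. *)
  exists (size E :: js); split=> //=; first by rewrite sj.
    by rewrite leqnn.
  by rewrite elim_step_id // nth_default // size_map.
have [j [ltj sat gt]] := elim_step_progress wE (lt_le_trans lt ex).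
have [|||js [sj aj kj]] := IH (elim_step E j); first exact: width_elim.
- by rewrite (elim_step_excess wE).
- lia.
exists (j :: js); split=> //=; first by rewrite sj.
by rewrite ltnW //=; rewrite size_map in aj.
Qed.

Lemma elim_steps_sound v E js : has_width v E ->
  exists2 z, size z = v & (average (foldl elim_step E js) <= list_excess z E)%R.
Proof.
elim: js E => [|j js IH] E wE /=; first exact: average_attained.
have [z sz le] := IH _ (width_elim j wE).
by have [z' sz' e] := elim_step_sound j wE sz; exists z'; rewrite ?e.
Qed.

(** * Systems as lists of equations *)

Notation eqn := (bool_row * seq bool)%type.

Fixpoint bits_value (w : seq bool) : nat :=
  if w is b :: w' then b + (bits_value w').*2 else 0.

Definition encode_eqn (e : eqn) : seq (option bool) :=
  [seq Some a | a <- e.1.1] ++ [:: None; Some e.1.2; None] ++ [seq Some a | a <- e.2] ++ [:: None].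

Definition encode_eqns v (E : seq eqn) : seq (option bool) :=
  nseq v (Some true) ++ None :: flatten [seq encode_eqn e | e <- E].

Definition wf_eqn v (e : eqn) : bool :=
  [&& size e.1.1 == v, true \in e.1.1 & last false e.2].

Definition with_values (E : seq eqn) : seq (bool_row * nat) := [seq (e.1, bits_value e.2) | e <- E].

Lemma bits_value_gt0 w : last false w -> 0 < bits_value w.
Proof.
suff h b : last b w -> 0 < b + bits_value w by move/h.
by elim: w b => [|c w IH] b /=; [case: b|move=> /IH; lia].
Qed.

Lemma binary_cons n : 1 < n -> binary n = odd n :: binary n./2.
Proof.
have mkS (f : nat -> bool) m : mkseq f m.+1 = f 0 :: mkseq (fun i => f i.+1) m.
  by rewrite /mkseq /= -[1]/(1 + 0) iotaDl -map_comp.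
move=> n1; rewrite /binary (trunc_log2S n1) mkS divn1; congr cons.
by apply: eq_map => i; rewrite expnS divnMA divn2.
Qed.

Lemma binary_bits_value w : last false w -> binary (bits_value w) = w.
Proof.
elim: w => //= b [|c w] IH l; first by move: l => /= ->.
have := bits_value_gt0 (l : last false (c :: w)); set u := bits_value (c :: w) => u0.
by rewrite binary_cons ?oddD ?odd_double ?half_bit_double ?IH //; [rewrite addbF oddb|lia].
Qed.

Lemma bits_value_binary n : 0 < n -> bits_value (binary n) = n /\ last false (binary n).
Proof.
have [m] := ubnP n; elim: m n => // m IH n; rewrite ltnS => lem n0.
have [n1|n1] := leqP n 1; first by have -> : n = 1 by lia.
have [||e l] := IH n./2; [lia|lia|].
rewrite binary_cons //; move: (binary n./2) e l => u /= -> l; split; first lia.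
by case: u l.
Qed.

Lemma eq1D (x y : 'F_2) : ((x + y)%R == 1%R) = (x == 1%R) (+) (y == 1%R).
Proof. by case: x y => [[|[|]]] // ? [[|[|]]]. Qed.

Lemma eq1M (x y : 'F_2) : ((x * y)%R == 1%R) = (x == 1%R) && (y == 1%R).
Proof. by case: x y => [[|[|]]] // ? [[|[|]]]. Qed.

Lemma eqE1 (x y : 'F_2) : (x == y) = ~~ ((x == 1%R) (+) (y == 1%R)).
Proof. by case: x y => [[|[|]]] // ? [[|[|]]]. Qed.

Lemma dot_map (I : Type) (s : seq I) (f g : I -> bool) :
  dot (map f s) (map g s) = \big[addb/false]_(i <- s) (f i && g i).
Proof. by elim: s => [|i s IH] /=; rewrite ?big_nil // big_cons IH. Qed.

Definition bits_of_col n (z : 'cV['F_2]_n) : seq bool := [seq z i 0%R == 1%R | i <- enum 'I_n].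

Definition col_of_bits n (z : seq bool) : 'cV['F_2]_n := (\col_i (nth false z i)%:R)%R.

Lemma col_of_bitsK n z : size z = n -> bits_of_col (col_of_bits n z) = z.
Proof.
move=> sz; apply: (@eq_from_nth _ false); first by rewrite size_map size_enum_ord sz.
move=> i; rewrite size_map size_enum_ord => lt.
rewrite (nth_map (Ordinal lt)) ?size_enum_ord // mxE nth_enum_ord //.
by case: nth.
Qed.

Definition equation_of (S : lin_system) (j : 'I_(equations S)) : eqn :=
  ([seq lhs S j i == 1%R | i <- enum 'I_(variables S)], rhs S j 0%R == 1%R, binary (weight j)).

Definition eqns_of (S : lin_system) : seq eqn := [seq equation_of j | j <- enum 'I_(equations S)].

Lemma satisfiesE (S : lin_system) z (j : 'I_(equations S)) :
  satisfies z j = ~~ violated (bits_of_col z) (equation_of j).1.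
Proof.
rewrite /satisfies eqE1 mxE /violated /= dot_map big_enum /=; congr (~~ (_ (+) _)).
rewrite (big_morph (fun x : 'F_2 => x == 1%R) (id1 := false) eq1D) //.
by apply: eq_bigr => i _; rewrite eq1M.
Qed.

Lemma excessE (S : lin_system) z :
  @excess S z = list_excess (bits_of_col z) (with_values (eqns_of S)).
Proof.
rewrite /list_excess /with_values /eqns_of 2!big_map big_enum (bigID (@satisfies S z)) /excess -sumrN.
have vw j : bits_value (@equation_of S j).2 = weight j.
  by have [] := bits_value_binary (weight_gt0 j).
by congr (_ + _)%R; apply: eq_bigr => j; rewrite satisfiesE /signed vw [fst (_, _)]/=; case: violated.
Qed.

Lemma max_excessP (S : lin_system) (k : int) :
  reflect (exists2 z, size z = variables S & (k <= list_excess z (with_values (eqns_of S)))%R)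
    (k <= max_excess S)%R.
Proof.
apply: (iffP idP) => [|[z sz le]].
  rewrite /max_excess; pose P t := (k <= t)%R -> exists2 z, size z = variables S & (k <= list_excess z (with_values (eqns_of S)))%R.
  have Pz z : P (@excess S z).
    rewrite excessE => le; exists (bits_of_col z) => //.
    by rewrite size_map size_enum_ord.
  apply: (big_ind P) => // x y Px Py; rewrite /P /Num.max; case: ifP => _ //.
rewrite -(col_of_bitsK sz) -excessE in le.
exact: le_trans le (le_bigmax _ _ _).
Qed.

Lemma eqns_of_wf (S : lin_system) : all (wf_eqn (variables S)) (eqns_of S).
Proof.
apply/allP=> _ /mapP [j _ ->]; apply/and3P.
have [_ l] := bits_value_binary (weight_gt0 j).
split; [by rewrite /= size_map size_enum_ord| |exact: l].
have : [exists i, lhs S j i != 0%R].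
  apply/contraT=> /existsPn z; case/eqP: (lhs_neq0 j); apply/rowP=> i.
  by rewrite !mxE; apply/eqP; rewrite -[_ == _]negbK z.
case/existsP=> i nz; apply/mapP; exists i; first by rewrite mem_enum.
by move: nz; case: (lhs S j i) => [[|[|]]].
Qed.

Lemma encode_eqns_of (S : lin_system) : encode S = encode_eqns (variables S) (eqns_of S).
Proof.
rewrite /encode /encode_eqns /eqns_of -map_comp; congr (_ ++ _ :: flatten _).
by apply: eq_map => j; rewrite /encode_equation /encode_eqn /= -!map_comp.
Qed.

Lemma eqns_of_surj v E : all (wf_eqn v) E -> exists2 S, variables S = v & eqns_of S = E.
Proof.
move=> wf; pose e0 : eqn := ([::], false, [::]).
pose A : 'M['F_2]_(size E, v) := (\matrix_(j, i) (nth false (nth e0 E j).1.1 i)%:R)%R.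
pose b : 'cV['F_2]_(size E) := (\col_j ((nth e0 E j).1.2)%:R)%R.
pose w (j : 'I_(size E)) := bits_value (nth e0 E j).2.
have wfj (j : 'I_(size E)) : wf_eqn v (nth e0 E j) by apply: (allP wf); apply: mem_nth.
have w0 j : 0 < w j by have /and3P [_ _ /bits_value_gt0] := wfj j.
have A0 j : row j A != 0%R.
  have /and3P [/eqP sa nz _] := wfj j.
  have lt : index true (nth e0 E j).1.1 < v by rewrite -sa index_mem.
  apply/eqP=> /rowP /(_ (Ordinal lt)); rewrite !mxE /= nth_index //.
exists (@LinSystem _ _ A b w w0 A0) => //.
apply: (@eq_from_nth _ e0); first by rewrite size_map size_enum_ord.
move=> j; rewrite size_map size_enum_ord /= => lt.
rewrite (nth_map (Ordinal lt)) ?size_enum_ord // /equation_of /= !mxE.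
have -> : nth (Ordinal lt) (enum 'I_(size E)) j = Ordinal lt by apply: val_inj; rewrite /= nth_enum_ord.
have /and3P [/eqP sa _ l] := wfj (Ordinal lt); rewrite /= in sa l.
rewrite binary_bits_value //.
have -> : [seq A (Ordinal lt) i == 1%R | i <- enum 'I_v] = (nth e0 E j).1.1.
  apply: (@eq_from_nth _ false); first by rewrite size_map size_enum_ord sa.
  move=> i; rewrite size_map size_enum_ord => lti.
  rewrite (nth_map (Ordinal lti)) ?size_enum_ord // mxE /= nth_enum_ord //.
  by case: (nth false _ _).
by case: (nth e0 E j) => [[a []] u].
Qed.

(** Passage from matrices to lists, the form in which the parser and the eliminations see an
    instance. *)
Lemma MaxLinAAP x k : MaxLinAA x k <-> exists v E,
  [/\ x = encode_eqns v E, all (wf_eqn v) E &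
    exists2 z, size z = v & (k%:Z <= list_excess z (with_values E))%R].
Proof.
split=> [[S -> /max_excessP h]|[v [E [-> wf h]]]].
  exists (variables S), (eqns_of S).
  by split=> //; [exact: encode_eqns_of|exact: eqns_of_wf].
have [S sv sE] := eqns_of_surj wf; exists S; first by rewrite encode_eqns_of sv sE.
by apply/max_excessP; rewrite sv sE.
Qed.

(** * Parsing *)

Definition isbit : pred sym := fun g => if g is Some (Some _) then true else false.

(** Symbols move one at a time, so their order is reversed on the target stack; moving them once
    more restores it. *)
Definition transfer (t : pred sym) i j :=
  loop i (oapp t false) (sw i (fun o => if o is Some g then pop i ;; push j g else skip)).

Definition move_all := transfer predT.

Definition discard (t : pred sym) i := loop i (oapp t false) (pop i).

Definition expect i (g : sym) := sw i (fun o => if o == Some g then pop i else fail).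

Section Specs.
Variable bs : nat -> bool.
Local Notation spec := (spec bs).

(** Comparison is made stack by stack, because padding with empty stacks changes the list but not
    what the tapes hold. *)
Lemma spec_congr M c s s1 c' o o1 T : (forall i, get s i = get s1 i) ->
  (forall i, omap (get^~ i) o = omap (get^~ i) o1) -> spec M c s1 c' o1 T -> spec M c s c' o T.
Proof.
move=> es eo sp tp h; have h1 : holds tp s1 by move=> i; rewrite -[nth _ _ _]es; apply: h.
have [n [tp' [le out]]] := sp _ h1; exists n, tp'; split=> //.
case: o o1 eo out {sp} => [s'|] [s1'|] eo //; try by have := eo 0.
case=> e h'; split=> // i; have [/= ei] := eo i.
by rewrite -/(get s' i) ei; apply: h'.
Qed.

Lemma get_set s i x j : get (set s i x) j = if j == i then x else get s j.
Proof. by rewrite /get /set nth_set_nth. Qed.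

Lemma spec_transfer (t : pred sym) i j c s l r : i <= naux -> j <= naux -> i != j ->
  get s i = l ++ r -> all t l -> ~~ oapp t false (ohead r) ->
  spec (transfer t i j) c s c (Some (set (set s i r) j (catrev l (get s j)))) (5 * size l).+1.
Proof.
move=> lei lej ne; elim: l s => [|g l IH] s /= gi.
  move=> _ tr; apply: (@spec_congr _ _ s s _ _ (Some s)) => //; last first.
    by apply: spec_loop_exit; rewrite ?gi.
  by move=> k /=; rewrite !get_set; case: eqP => [->|_] //; case: eqP => [->|_] //; rewrite gi.
case/andP=> tg al tr.
pose s1 := set (set s i (l ++ r)) j (g :: get s j).
(* Five steps per symbol: loop test, symbol test, pop, and two for the push. The additional one is
   the last loop test. *)
have -> : (5 * (size l).+1).+1 = ((1 + (1 + 2)) + (5 * size l).+1).+1 by lia.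
have gij : get (set s i (l ++ r)) j = get s j by rewrite get_set eq_sym (negPf ne).
apply: (@spec_loop_step _ _ _ _ _ _ _ s1); rewrite ?gi //=.
  apply: spec_sw => //; rewrite gi /=; apply: spec_seq; first exact: spec_pop.
  by rewrite gi /= /s1 -gij; exact: spec_push.
apply: spec_congr (IH s1 _ al tr) => // [k|]; last by rewrite get_set (negPf ne) get_set eqxx.
by rewrite /= !get_set eqxx; case: eqP => //; case: eqP.
Qed.

Lemma spec_move i j c s : i <= naux -> j <= naux -> i != j ->
  spec (move_all i j) c s c (Some (set (set s i [::]) j (catrev (get s i) (get s j))))
    (5 * size (get s i)).+1.
Proof.
by move=> lei lej ne; apply: spec_transfer => //; rewrite ?cats0 //; apply/allP.
Qed.

Lemma spec_discard (t : pred sym) i c s l r : i <= naux -> get s i = l ++ r -> all t l ->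
  ~~ oapp t false (ohead r) -> spec (discard t i) c s c (Some (set s i r)) (2 * size l).+1.
Proof.
move=> lei; elim: l s => [|g l IH] s /= gi.
  move=> _ tr; apply: (@spec_congr _ _ s s _ _ (Some s)) => //; last first.
    by apply: spec_loop_exit; rewrite ?gi.
  by move=> k /=; rewrite !get_set; case: eqP => [->|_] //; rewrite gi.
case/andP=> tg al tr; have -> : (2 * (size l).+1).+1 = (1 + (2 * size l).+1).+1 by lia.
apply: (@spec_loop_step _ _ _ _ _ _ _ (set s i (l ++ r))); rewrite ?gi //=.
  by rewrite -[l ++ r]/(behead (g :: l ++ r)) -gi; exact: spec_pop.
apply: spec_congr (IH (set s i (l ++ r)) _ al tr) => // [k|]; last by rewrite get_set eqxx.
by rewrite /= !get_set; case: eqP.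
Qed.

Lemma spec_eq M c s c' o1 o2 T : spec M c s c' o1 T -> o1 = o2 -> spec M c s c' o2 T.
Proof. by move=> sp <-. Qed.

End Specs.
Ltac compute_stacks := rewrite ?/get ?/set /=.

Ltac run_code :=
  lazymatch goal with
  | |- spec _ (seqp _ _) _ _ _ _ _ => eapply spec_seq; [run_code | compute_stacks; run_code]
  | |- spec _ (sw _ _) _ _ _ _ _ => eapply spec_sw; [done | compute_stacks; run_code]
  | |- spec _ (pop _) _ _ _ _ _ => exact: spec_pop
  | |- spec _ (push _ _) _ _ _ _ _ => exact: spec_push
  | |- spec _ skip _ _ _ _ _ => exact: spec_skip
  | |- spec _ fail _ _ _ _ _ => exact: spec_fail
  | _ => idtac
  end.

Notation one := (bit true).

(** The last symbol of a row tells its right-hand side. *)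
Definition end_mark (b : bool) : sym := if b then par else sep.

Definition row_code (r : bool_row) : seq sym := rcons [seq bit b | b <- r.1] (end_mark r.2).

Definition weight_code (w : seq bool) : seq sym := rcons [seq bit b | b <- w] sep.

Definition expect_bit i (p : bool -> prog) :=
  sw i (fun o => if o is Some (Some (Some b)) then p b else fail).

(** Stacks: 0 input, 1 number of variables in unary, 2 rows, 3 weights, 4 number of
    equations in unary, 5 to 11 work space; while parsing, rows and weights are
    collected in reverse on 5 and 6, and 11 becomes nonempty at a nonzero coefficient. *)
Definition parse_coefs :=
  loop 1 isSome (pop 1 ;; push 7 one ;;
    sw 0 (fun o => if o is Some (Some (Some b)) then
                     pop 0 ;; push 5 (bit b) ;; (if b then push 11 one else skip)
                   else fail)).

(** Two conditions go beyond the syntax: stack 11 is nonempty exactly when some coefficient is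
    nonzero, and after the transfer the most significant digit of the weight lies on top of stack
    6. *)
Definition parse_eqn :=
  parse_coefs ;; move_all 7 1 ;; expect 0 sep ;;
  sw 11 (fun o => if o is Some _ then discard predT 11 else fail) ;;
  expect_bit 0 (fun b => pop 0 ;; push 5 (end_mark b)) ;;
  expect 0 sep ;; transfer isbit 0 6 ;; expect 0 sep ;;
  sw 6 (fun o => if o == Some one then skip else fail) ;;
  push 6 sep ;; push 4 one.

(** * A reference parser on lists, and its agreement with the stack program *)

Fixpoint read_coefs v (y : seq (option bool)) : option (seq bool * seq (option bool)) :=
  if v is v'.+1 then
    if y is Some b :: y' then omap (fun p => (b :: p.1, p.2)) (read_coefs v' y') else None
  else Some ([::], y).

Fixpoint read_bits (y : seq (option bool)) : seq bool * seq (option bool) :=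
  if y is Some b :: y' then (b :: (read_bits y').1, (read_bits y').2) else ([::], y).

Definition read_weight (y : seq (option bool)) : option (seq bool * seq (option bool)) :=
  if read_bits y is (w, None :: y') then if last false w then Some (w, y') else None else None.

Definition read_after_coefs (p : seq bool * seq (option bool)) : option (eqn * seq (option bool)) :=
  if p is (a, None :: Some b :: None :: y) then
    if true \in a then omap (fun q => ((a, b, q.1), q.2)) (read_weight y) else None
  else None.
Arguments read_after_coefs : simpl never.

Definition read_eqn v y := obind read_after_coefs (read_coefs v y).

Section ParseSpecs.
Variable bs : nat -> bool.
Local Notation spec := (spec bs).

(** A rejecting halt of the program mirrors [None] in the reference parser. *)
Lemma spec_obind X M1 M2 c s (r : option X) f o T1 T2 :
  spec M1 c s c (omap f r) T1 -> (forall x, r = Some x -> spec M2 c (f x) c (o x) T2) ->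
  spec (M1 ;; M2) c s c (obind o r) (T1 + T2).
Proof.
case: r => [x|] sp1 sp2 /=; first by apply: spec_seq sp1 (sp2 _ _).
by apply: spec_le (spec_seq_fail _ sp1) _; apply: leq_addr.
Qed.

Lemma spec_expect i g c s : i <= naux -> ohead (get s i) = Some g ->
  spec (expect i g) c s c (Some (set s i (behead (get s i)))) 2.
Proof. by move=> lei e; apply: spec_sw; rewrite // e eqxx; apply: spec_pop. Qed.

Lemma spec_expect_fail i g c s : i <= naux -> ohead (get s i) != Some g ->
  spec (expect i g) c s c None 1.
Proof. by move=> lei /negPf e; apply: spec_sw; rewrite // e; apply: spec_fail. Qed.

Lemma spec_push_if (b : bool) i g c s : i <= naux ->
  spec (if b then push i g else skip) c s c (Some (set s i (nseq b g ++ get s i))) 2.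
Proof.
move=> lei; case: b; first exact: spec_push.
apply: (@spec_congr _ _ _ s s _ _ (Some s)) => //; last by apply: (@spec_le _ _ _ _ _ _ 1) => //; apply: spec_skip.
by move=> k /=; rewrite get_set; case: eqP => // ->.
Qed.

Lemma spec_expect_bit i p b c s c' o T : i <= naux -> ohead (get s i) = Some (bit b) ->
  spec (p b) c s c' o T -> spec (expect_bit i p) c s c' o T.+1.
Proof. by move=> lei e sp; apply: spec_sw; rewrite // e. Qed.

Lemma spec_expect_bit_fail i p c s : i <= naux -> (forall b, ohead (get s i) <> Some (bit b)) ->
  spec (expect_bit i p) c s c None 1.
Proof.
move=> lei e; apply: spec_sw => //; case: (ohead _) e => [[[b|]|]|] e; try exact: spec_fail.
by case: (e b).
Qed.

Lemma spec_parse_coefs v y k R W M R' P Q D J U F c :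
  spec parse_coefs c [:: instance_word y k; nseq v one; R; W; M; R'; P; Q; D; J; U; F] c
    (omap (fun p => [:: instance_word p.2 k; [::]; R; W; M; catrev [seq bit b | b <- p.1] R'; P;
                        catrev (nseq v one) Q; D; J; U; nseq (count id p.1) one ++ F])
       (read_coefs v y)) (11 * v).+1.
Proof.
elim: v y R' Q F => [|v IH] y R' Q F; first exact: spec_loop_exit.
case: y => [|[b|] y].
- eapply spec_le; first eapply spec_loop_fail => //.
    eapply spec_seq; first exact: spec_pop.
    eapply spec_seq; first exact: spec_push.
    compute_stacks; apply: (@spec_sw _ _ _ _ _ _ _ 0) => //.
    by compute_stacks; rewrite /instance_word /=; case: {IH} k => [|k] /=; apply: spec_fail.
  by lia.
- eapply spec_le.
    eapply spec_loop_step; [by []|by []| |].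
      run_code; exact: spec_push_if.
    compute_stacks; eapply spec_eq; first exact: IH.
    by rewrite /=; case: (read_coefs v y) => //= p; rewrite addnC nseqD catA.
  by lia.
- eapply spec_le; first eapply spec_loop_fail => //.
    eapply spec_seq; first exact: spec_pop.
    eapply spec_seq; first exact: spec_push.
    by compute_stacks; eapply spec_sw; last exact: spec_fail.
  by lia.
Qed.

(** Time as a budget: the total is fixed in advance and each component leaves one inequality. *)
Lemma spec_step M1 M2 c s c1 s1 c2 o T1 T : spec M1 c s c1 (Some s1) T1 -> T1 <= T ->
  spec M2 c1 s1 c2 o (T - T1) -> spec (M1 ;; M2) c s c2 o T.
Proof. by move=> sp1 le sp2; apply: spec_le (spec_seq sp1 sp2) _; rewrite subnKC. Qed.

Lemma spec_stop M1 M2 c s c1 T1 T : spec M1 c s c1 None T1 -> T1 <= T ->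
  spec (M1 ;; M2) c s c1 None T.
Proof. by move=> sp1 le; apply: spec_le (spec_seq_fail _ sp1) le. Qed.

Lemma size_read_coefs v y p : read_coefs v y = Some p -> size p.1 = v /\ size y = v + size p.2.
Proof.
elim: v y p => [|v IH] y p /=; first by case=> <-.
case: y => [|[b|] y] //; case e: (read_coefs v y) => [q|] //= [<-] /=.
by have [-> ->] := IH _ _ e; rewrite addSn.
Qed.

Lemma read_bitsE y : y = [seq Some b | b <- (read_bits y).1] ++ (read_bits y).2.
Proof. by elim: y => [|[b|] y IH] //=; rewrite -IH. Qed.

Lemma read_bits_stop y : if (read_bits y).2 is Some _ :: _ then False else True.
Proof. by elim: y => [|[b|] y IH]. Qed.

(** Past the end of [y] the top symbol is a parameter letter or a blank, so no test for a bit or a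
    separator succeeds there. *)
Lemma top_instance (y : seq (option bool)) k g :
  (ohead (instance_word y k) == Some (Some g)) = (ohead y == Some g).
Proof. by case: y => [|a y] //; rewrite /instance_word /=; case: k. Qed.

(** The hypothesis on [P] concerns empty weights: the top of stack 6 is then the top of [P], which
    must not pass for a most significant digit. *)
Lemma spec_parse_eqn v y k R W M R' P D J U c : ohead P != Some one ->
  spec parse_eqn c [:: instance_word y k; nseq v one; R; W; M; R'; P; [::]; D; J; U; [::]] c
    (omap (fun p => [:: instance_word p.2 k; nseq v one; R; W; one :: M;
                        catrev (row_code p.1.1) R'; catrev (weight_code p.1.2) P; [::];
                        D; J; U; [::]])
       (read_eqn v y)) (20 * (v + size y) + 40).
Proof.
move=> topP; rewrite /parse_eqn.
set F := (fun p : eqn * _ => _).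
have -> : omap F (read_eqn v y) = obind (fun p => omap F (read_after_coefs p)) (read_coefs v y).
  by rewrite /read_eqn; case: (read_coefs v y).
have -> : 20 * (v + size y) + 40 = (11 * v).+1 + (9 * v + 20 * size y + 39) by lia.
eapply spec_obind; first exact: spec_parse_coefs.
move=> [a y1] /size_read_coefs /= [sa sy]; rewrite sy {sy}.
set T := _ + 39; have {T} -> : T = 29 * v + 20 * size y1 + 39 by rewrite /T; lia.
rewrite [catrev (nseq _ _) _]catrevE rev_nseq !cats0.
eapply spec_step; [exact: spec_move|by rewrite /= size_nseq; lia|].
compute_stacks; rewrite size_nseq catrevE rev_nseq cats0.
case: y1 => [|[b1|] y1]; try
  by apply: spec_stop; [apply: spec_expect_fail => //; rewrite ?top_instance|lia].
eapply spec_step; [exact: spec_expect|by lia|compute_stacks].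
have cnt : count id a <= v by rewrite -sa count_size.
have cnt0 : (true \in a) = (0 < count id a).
  by rewrite -has_count; apply/idP/hasP => [ta|[[] //]]; exists true.
have [ta|na] := boolP (true \in a); last first.
  rewrite (_ : read_after_coefs _ = None); last first.
    by rewrite /read_after_coefs (negbTE na); case: y1 => [|[b|] [|[b'|] y1]].
  apply: spec_stop; [apply: (@spec_sw _ _ _ _ _ _ _ 0) => //; compute_stacks|by lia].
  by case: (count id a) cnt0 na => [|n] -> //= _; apply: spec_fail.
eapply spec_step; [eapply spec_sw => //; compute_stacks| |].
- have -> : ohead (nseq (count id a) one) = Some one by case: (count id a) cnt0 ta => [-> //|].
  by apply: (@spec_discard _ predT 11 _ _ (nseq (count id a) one) [::]); rewrite /= ?cats0 ?all_nseq ?orbT.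
- by rewrite size_nseq; lia.
compute_stacks; rewrite size_nseq.
rewrite -/(instance_word _ _); case: y1 => [|[b|] y1].
- by apply: spec_stop; [apply: spec_expect_bit_fail => // b; apply/eqP; rewrite top_instance|rewrite /=; lia].
- eapply spec_step; [eapply spec_expect_bit; [by []|by []|by run_code]|by rewrite /=; lia|].
  compute_stacks; rewrite -/(instance_word _ _).
  case: y1 => [|[b'|] y1]; try
    by apply: spec_stop; [apply: spec_expect_fail => //; rewrite ?top_instance|rewrite /=; lia].
  eapply spec_step; [exact: spec_expect|by rewrite /=; lia|].
  compute_stacks; rewrite -/(instance_word _ _).
  rewrite /read_after_coefs ta /read_weight.
  move: (read_bitsE y1) (read_bits_stop y1); case: (read_bits y1) => w y2 /= e1 st.
  have inst1 : instance_word y1 k = [seq bit b | b <- w] ++ instance_word y2 k.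
    by rewrite e1 /instance_word map_cat -map_comp -catA.
  have sy1 : size y1 = size w + size y2 by rewrite e1 size_cat size_map.
  eapply spec_step; first apply: (@spec_transfer _ isbit 0 6 _ _ [seq bit b | b <- w] (instance_word y2 k)) => //.
  + by apply/allP=> _ /mapP [? _ ->].
  + by case: y2 st {e1 inst1 sy1} => [|[]] //=; case: (k).
  + by rewrite size_map; lia.
  compute_stacks; rewrite size_map.
  case: y2 st {e1 inst1} sy1 => [|[//|] y2] _ sy1.
    by apply: spec_stop; [apply: spec_expect_fail => //; rewrite top_instance|rewrite /=; lia].
  eapply spec_step; [exact: spec_expect|by rewrite /= in sy1 *; lia|].
  compute_stacks; rewrite -/(instance_word _ _).
  have topw : (ohead (catrev [seq bit b | b <- w] P) == Some one) = last false w.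
    case/lastP: w {sy1} => [|w b']; first by rewrite /= (negPf topP).
    by rewrite map_rcons catrevE rev_rcons last_rcons /=; case: b'.
  case lw: (last false w); last first.
    by apply: spec_stop; [apply: (@spec_sw _ _ _ _ _ _ _ 0) => //; compute_stacks; rewrite topw lw; apply: spec_fail|rewrite /= in sy1 *; lia].
  eapply spec_step; [eapply spec_sw; [by []|compute_stacks; rewrite topw lw; exact: spec_skip]| |].
    by rewrite /= in sy1 *; lia.
  eapply spec_le; first eapply spec_eq; first run_code.
    by rewrite /F /= /row_code /weight_code !catrevE !rev_rcons.
  by rewrite /= in sy1 *; lia.
- by apply: spec_stop; [apply: spec_expect_bit_fail => // b; apply/eqP; rewrite top_instance|rewrite /=; lia].
Qed.

End ParseSpecs.

(** * Parsing a whole system *)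

Definition rows_code (rs : seq bool_row) : seq sym := flatten [seq row_code r | r <- rs].

Definition weights_code (ws : seq (seq bool)) : seq sym := flatten [seq weight_code w | w <- ws].

Definition parse :=
  transfer (pred1 one) 0 1 ;; expect 0 sep ;;
  loop 0 (fun o => if o is Some (Some _) then true else false) parse_eqn ;;
  move_all 5 2 ;; move_all 6 3.

(** [n] is fuel; an equation occupies at least one symbol, so the length of [y] is enough. *)
Fixpoint read_eqns n v (y : seq (option bool)) : option (seq eqn) :=
  match y, n with
  | [::], _ => Some [::]
  | _, 0 => None
  | _, n'.+1 => obind (fun p => omap (cons p.1) (read_eqns n' v p.2)) (read_eqn v y)
  end.

Fixpoint read_ones (x : seq (option bool)) : nat * seq (option bool) :=
  if x is Some true :: x' then ((read_ones x').1.+1, (read_ones x').2) else (0, x).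

Definition read_system (x : seq (option bool)) : option (nat * seq eqn) :=
  if read_ones x is (v, None :: y) then omap (pair v) (read_eqns (size y) v y) else None.

Lemma read_coefs_sound v y p : read_coefs v y = Some p ->
  size p.1 = v /\ y = [seq Some b | b <- p.1] ++ p.2.
Proof.
elim: v y p => [|v IH] y p /=; first by case=> <-.
case: y => [|[b|] y] //; case e: (read_coefs v y) => [q|] //= [<-] /=.
by have [-> {1}->] := IH _ _ e.
Qed.

Lemma read_coefs_complete a y : read_coefs (size a) ([seq Some b | b <- a] ++ y) = Some (a, y).
Proof. by elim: a => //= b a ->. Qed.

Lemma read_eqn_sound v y p : read_eqn v y = Some p -> wf_eqn v p.1 /\ y = encode_eqn p.1 ++ p.2.
Proof.
rewrite /read_eqn; case e: (read_coefs v y) => [[a y1]|] //=.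
have [/= sa ->] := read_coefs_sound e; rewrite /read_after_coefs.
case: y1 {e} => [|[b1|] [|[b|] [|[b3|] y3]]] //.
case: ifP => // ta; rewrite /read_weight; have := read_bitsE y3.
case: (read_bits y3) => w [|[b4|] y4] //= ->; case: ifP => // lw [<-] /=.
by rewrite /wf_eqn /= sa eqxx ta lw /encode_eqn /= -!catA /= -catA.
Qed.

Lemma read_eqn_complete v e y : wf_eqn v e -> read_eqn v (encode_eqn e ++ y) = Some (e, y).
Proof.
case: e => [[a b] w] /and3P [/= /eqP sa ta lw].
rewrite /encode_eqn /= -!catA -sa /read_eqn read_coefs_complete /= /read_after_coefs ta -catA.
rewrite /read_weight; have -> : read_bits ([seq Some b | b <- w] ++ None :: y) = (w, None :: y).
  by elim: w {lw} => //= b' w ->.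
by rewrite lw.
Qed.

Lemma size_encode_eqn e : size (encode_eqn e) = size e.1.1 + size e.2 + 4.
Proof. by rewrite /encode_eqn !(size_cat, size_map) /=; lia. Qed.

Lemma encode_eqn_gt0 e : 0 < size (encode_eqn e).
Proof. by rewrite size_encode_eqn addnS. Qed.

Lemma size_row_code r : size (row_code r) = (size r.1).+1.
Proof. by rewrite size_rcons size_map. Qed.

Lemma size_weight_code w : size (weight_code w) = (size w).+1.
Proof. by rewrite size_rcons size_map. Qed.

Lemma read_eqns_sound n v y E : read_eqns n v y = Some E ->
  all (wf_eqn v) E /\ y = flatten [seq encode_eqn e | e <- E].
Proof.
elim: n y E => [|n IH] [|a y] E //=; try by case=> <-.
case e: (read_eqn _ _) => [[d y']|] //=; case e': (read_eqns _ _ _) => [E'|] //= [<-].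
have [/= wd ->] := read_eqn_sound e; have [wE ->] := IH _ _ e'.
by rewrite wd wE.
Qed.

Lemma read_eqns_complete n v E : all (wf_eqn v) E ->
  size (flatten [seq encode_eqn e | e <- E]) <= n ->
  read_eqns n v (flatten [seq encode_eqn e | e <- E]) = Some E.
Proof.
elim: E n => [|e E IH] n /=; first by case: n.
case/andP=> we wE; rewrite size_cat => le; have := read_eqn_complete (flatten [seq encode_eqn e | e <- E]) we.
have := encode_eqn_gt0 e; move: le; set u := encode_eqn e; case: u => //= g u le _.
case: n le => // n le e1; rewrite /= e1 /= IH //; lia.
Qed.

Lemma read_onesE x : x = nseq (read_ones x).1 (Some true) ++ (read_ones x).2.
Proof. by elim: x => [|[[]|] x IH] //=; rewrite -IH. Qed.

Lemma read_ones_stop x : ohead (read_ones x).2 != Some (Some true).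
Proof. by elim: x => [|[[]|] x IH]. Qed.

Lemma read_systemP x v E : read_system x = Some (v, E) <-> x = encode_eqns v E /\ all (wf_eqn v) E.
Proof.
rewrite /read_system; split=> [|[-> wE]].
  have := read_onesE x; case: (read_ones x) => u [|[b|] y] //= ex.
  case e: (read_eqns _ _ _) => [E'|] //= [<- <-].
  by have [wE ey] := read_eqns_sound e; rewrite ex ey.
have -> : read_ones (encode_eqns v E) = (v, None :: flatten [seq encode_eqn e | e <- E]).
  by rewrite /encode_eqns; elim: v {wE} => //= v ->.
by rewrite read_eqns_complete.
Qed.

Section ParseSystem.
Variable bs : nat -> bool.
Local Notation spec := (spec bs).

(** [N] bounds the cost of each equation uniformly, and the length of [y] bounds their number. *)
Lemma spec_parse_eqns n N v y k R W M R' P D J U c :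
  ohead P != Some one -> size y <= n -> v + size y <= N ->
  spec (loop 0 (fun o => if o is Some (Some _) then true else false) parse_eqn) c
    [:: instance_word y k; nseq v one; R; W; M; R'; P; [::]; D; J; U; [::]] c
    (omap (fun E => [:: nseq k par; nseq v one; R; W; nseq (size E) one ++ M;
                        catrev (rows_code (unzip1 E)) R'; catrev (weights_code (unzip2 E)) P;
                        [::]; D; J; U; [::]])
       (read_eqns n v y)) ((20 * N + 41) * size y).+1.
Proof.
elim: n y M R' P => [|n IH] y M R' P topP; case: y => [|a y] // le leN.
- apply: (@spec_le _ _ _ _ _ _ 1) => //.
  by apply: spec_loop_exit => //; rewrite /instance_word; case: (k).
- apply: (@spec_le _ _ _ _ _ _ 1) => //.
  by apply: spec_loop_exit => //; rewrite /instance_word; case: (k).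
have sp := @spec_parse_eqn bs v (a :: y) k R W M R' P D J U c topP.
have [e|[[d y'] e]] : read_eqn v (a :: y) = None \/ exists p, read_eqn v (a :: y) = Some p.
  by case: (read_eqn _ _) => [p|]; [right; exists p|left].
- rewrite [read_eqns _ _ _]/= e /=; rewrite e /= in sp.
  eapply spec_le; first by apply: spec_loop_fail sp.
  by rewrite /= in leN *; nia.
- rewrite [read_eqns _ _ _]/= e /=; rewrite e in sp.
  have sy : size (a :: y) = size (encode_eqn d) + size y'.
    by have [_ ->] := read_eqn_sound e; rewrite size_cat.
  have pos := encode_eqn_gt0 d; rewrite /= in sy leN le.
  eapply spec_le.
    eapply spec_loop_step; [by []|by []|exact: sp|].
    eapply spec_eq; first apply: (IH y').
    + by rewrite catrevE /weight_code rev_rcons.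
    + by lia.
    + by lia.
    case: (read_eqns n v y') => //= E; congr Some.
    rewrite /rows_code /weights_code /= !catrev_catl.
    have -> : nseq (size E) one ++ one :: M = one :: nseq (size E) one ++ M by elim: (size E) => //= l ->.
    by [].
  by rewrite /=; nia.
Qed.

Lemma size_codes v E : all (wf_eqn v) E ->
  size (rows_code (unzip1 E)) + size (weights_code (unzip2 E)) <= size (flatten [seq encode_eqn e | e <- E]).
Proof.
elim: E => //= e E IH /andP [_ /IH le].
rewrite /rows_code /weights_code /= 3!size_cat -/(rows_code _) -/(weights_code _).
by rewrite size_encode_eqn size_row_code size_weight_code; lia.
Qed.

Lemma spec_parse y k c :
  spec parse c [:: instance_word y k; [::]; [::]; [::]; [::]; [::]; [::]; [::]; [::]; [::]; [::]; [::]] c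
    (omap (fun p => [:: nseq k par; nseq p.1 one; rows_code (unzip1 p.2); weights_code (unzip2 p.2);
                        nseq (size p.2) one; [::]; [::]; [::]; [::]; [::]; [::]; [::]])
       (read_system y)) (20 * (size y) ^ 2 + 60 * size y + 20).
Proof.
rewrite /parse /read_system; move: (read_onesE y) (read_ones_stop y).
case: (read_ones y) => v y1 /= -> st {y}; rewrite size_cat size_nseq.
have e : instance_word (nseq v (Some true) ++ y1) k = nseq v one ++ instance_word y1 k.
  by rewrite /instance_word map_cat map_nseq catA.
eapply spec_step; first apply: (@spec_transfer _ (pred1 one) 0 1 _ _ (nseq v one) (instance_word y1 k)) => //.
- by rewrite all_nseq /= eqxx orbT.
- have := top_instance y1 k (Some true); rewrite (negbTE st).
  by case: (instance_word y1 k) => //= a l /negbT.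
- by rewrite size_nseq; nia.
compute_stacks; rewrite size_nseq catrevE cats0 rev_nseq.
case: y1 st {e} => [|[b|] y1] st; try
  by apply: spec_stop; [apply: spec_expect_fail => //; rewrite ?top_instance|rewrite /=; nia].
eapply spec_step; [exact: spec_expect|by rewrite /=; nia|].
compute_stacks; rewrite -/(instance_word _ _).
rewrite -(addnA _ (60 * _)).
case e: (read_eqns _ v y1) => [E|]; last first.
  apply: spec_stop.
    by have := @spec_parse_eqns (size y1) (v + size y1) v y1 k [::] [::] [::] [::] [::] [::] [::] [::] c isT (leqnn _) (leqnn _); rewrite e => sp; exact: sp.
  by nia.
have := @spec_parse_eqns (size y1) (v + size y1) v y1 k [::] [::] [::] [::] [::] [::] [::] [::] c isT (leqnn _) (leqnn _); rewrite e.
move=> sp; eapply spec_step; [exact: sp|by nia|].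
have [wE ey] := read_eqns_sound e; have := size_codes wE; rewrite -ey => sz.
(* Rows and weights were collected in reverse; the two final moves restore their order. *)
have revrev (s : seq sym) : catrev (catrev s [::]) [::] = s by rewrite !catrevE !cats0 revK.
have szr (s : seq sym) : size (catrev s [::]) = size s by rewrite catrevE cats0 size_rev.
rewrite cats0.
eapply spec_step; [exact: spec_move|by rewrite /= szr; nia|].
compute_stacks; rewrite revrev szr.
eapply spec_le; first eapply spec_eq; first exact: spec_move.
  by compute_stacks; rewrite revrev.
by rewrite /= szr; nia.
Qed.

End ParseSystem.

(** * Guessing an equation *)

Definition halve :=
  loop 8 isSome (pop 8 ;; push 10 one ;;
    sw 8 (fun o => if o is Some _ then pop 8 ;; push 7 one else skip)).

(** The set of [d] remaining unary digits on stack 8 is halved; the other half,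
    rounded up, is added to the guess on stack 9 or discarded. *)
Definition guess_step := halve ;; move_all 7 8 ;; choice (move_all 10 9) (discard predT 10).

Definition guess :=
  move_all 4 7 ;; loop 7 isSome (pop 7 ;; push 4 one ;; push 8 one) ;; loop 8 isSome guess_step.

(** Since [d] is the sum of [uphalf d] and [d./2], the value lies between 0 and [d]; the value [d]
    itself is the idle index. *)
Fixpoint guessed d (bl : seq bool) : nat :=
  if bl is b :: bl' then (if b then uphalf d else 0) + guessed d./2 bl' else 0.

(** The number of halvings that bring [d] to 0. It does not depend on the bits, so all guesses cost
    the same number of choices. *)
Definition guess_length d := if d is 0 then 0 else (trunc_log 2 d).+1.

Lemma guess_lengthS d : 0 < d -> guess_length d = (guess_length d./2).+1.
Proof. by case: d => [|[|d]] // _; rewrite /guess_length trunc_log2S. Qed.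

Lemma guessed_le d bl : guessed d bl <= d.
Proof. by elim: bl d => //= b bl IH d; have := IH d./2; case: b; lia. Qed.

(** Greedy: the larger half is taken exactly when [j] reaches it, and in both cases at most [d./2]
    remains to be represented. *)
Lemma guessed_surj d j : j <= d -> exists2 bl, size bl = guess_length d & guessed d bl = j.
Proof.
have [n] := ubnP d; elim: n d j => // n IH d j ltd le.
have [d0|d0] := posnP d; first by exists [::]; move: le; rewrite d0 ?leqn0 // => /eqP.
rewrite (guess_lengthS d0); have [le2|lt2] := leqP (uphalf d) j.
  have [||bl sb gb] := IH d./2 (j - uphalf d); [lia|lia|].
  by exists (true :: bl); rewrite /= ?sb // gb subnKC.
have [||bl sb gb] := IH d./2 j; [lia|lia|].
by exists (false :: bl); rewrite /= ?sb // gb.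
Qed.

Lemma nseq_swap (T : Type) n (a : T) l : nseq n a ++ a :: l = a :: nseq n a ++ l.
Proof. by elim: n => //= n ->. Qed.

Section GuessSpecs.
Variable bs : nat -> bool.
Local Notation spec := (spec bs).

Lemma spec_halve d X V R W M R' P Q J U F c :
  spec halve c [:: X; V; R; W; M; R'; P; Q; nseq d one; J; U; F] c
    (Some [:: X; V; R; W; M; R'; P; nseq d./2 one ++ Q; [::]; J; nseq (uphalf d) one ++ U; F])
    (10 * d).+1.
Proof.
have [n] := ubnP d; elim: n d Q U => // n IH [|[|d]] Q U ltd.
- exact: spec_loop_exit.
- eapply spec_le.
    eapply spec_loop_step; [by []|by []|by run_code|exact: spec_loop_exit].
  by [].
- eapply spec_le.
    eapply spec_loop_step; [by []|by []|by run_code|].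
    by compute_stacks; eapply spec_eq; [apply: IH; lia|rewrite !nseq_swap].
  by lia.
Qed.

Lemma spec_guess_step d j X V R W M R' P F c :
  spec guess_step c [:: X; V; R; W; M; R'; P; [::]; nseq d one; nseq j one; [::]; F] c.+1
    (Some [:: X; V; R; W; M; R'; P; [::]; nseq d./2 one;
              nseq ((if bs c then uphalf d else 0) + j) one; [::]; F]) (20 * d + 5).
Proof.
eapply spec_step; [exact: spec_halve|lia|rewrite !cats0].
eapply spec_step; [exact: spec_move|by rewrite /= size_nseq; lia|].
compute_stacks; rewrite size_nseq catrevE cats0 rev_nseq.
eapply spec_le; first apply: spec_choice.
  case: (bs c).
    eapply spec_le; first (eapply spec_eq; first exact: spec_move).
      by compute_stacks; rewrite catrevE rev_nseq -nseqD.
    by rewrite /= size_nseq; exact: leqnn.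
  eapply spec_le; first apply: (@spec_discard _ predT 10 _ _ (nseq (uphalf d) one) [::]) => //.
  - by rewrite cats0.
  - by rewrite all_nseq orbT.
  - by rewrite size_nseq; lia.
by lia.
Qed.

Definition choices c n := mkseq (fun i => bs (c + i)) n.

Lemma choicesS c n : choices c n.+1 = bs c :: choices c.+1 n.
Proof.
rewrite /choices /mkseq /= addn0 -[1]/(1 + 0) iotaDl -map_comp; congr cons.
by apply: eq_map => i /=; rewrite addnA addn1.
Qed.

Lemma spec_guess_loop d j X V R W M R' P F c :
  spec (loop 8 isSome guess_step) c [:: X; V; R; W; M; R'; P; [::]; nseq d one; nseq j one; [::]; F]
    (c + guess_length d)
    (Some [:: X; V; R; W; M; R'; P; [::]; [::];
              nseq (guessed d (choices c (guess_length d)) + j) one; [::]; F]) ((20 * d + 7) * d).+1.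
Proof.
have [n] := ubnP d; elim: n d j c => // n IH d j c ltd.
have [->|d0] := posnP d.
  by rewrite addn0 /=; apply: (@spec_le _ _ _ _ _ _ 1) => //; exact: spec_loop_exit.
rewrite (guess_lengthS d0) choicesS -addSnnS [guessed _ _]/=.
eapply spec_le.
  eapply spec_loop_step; [by []|by rewrite /get /=; case: (d) d0|exact: spec_guess_step|].
  eapply spec_eq; first by apply: IH; lia.
  by rewrite addnCA addnA.
have [h [eh lh]] : exists h, d./2 = h /\ 2 * h <= d by exists d./2; lia.
by rewrite eh; nia.
Qed.

Lemma spec_guess m X V R W R' P F c :
  spec guess c [:: X; V; R; W; nseq m one; R'; P; [::]; [::]; [::]; [::]; F] (c + guess_length m)
    (Some [:: X; V; R; W; nseq m one; R'; P; [::]; [::];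
              nseq (guessed m (choices c (guess_length m))) one; [::]; F]) (20 * m ^ 2 + 18 * m + 3).
Proof.
have dup l M D : spec (loop 7 isSome (pop 7 ;; push 4 one ;; push 8 one)) c
    [:: X; V; R; W; M; R'; P; nseq l one; D; [::]; [::]; F] c
    (Some [:: X; V; R; W; nseq l one ++ M; R'; P; [::]; nseq l one ++ D; [::]; [::]; F]) (6 * l).+1.
  elim: l M D => [|l IH] M D; first exact: spec_loop_exit.
  eapply spec_le.
    eapply spec_loop_step; [by []|by []|by run_code|].
    by compute_stacks; eapply spec_eq; [exact: IH|rewrite !nseq_swap].
  by lia.
eapply spec_step; [exact: spec_move|by rewrite /= size_nseq; lia|].
compute_stacks; rewrite size_nseq catrevE cats0 rev_nseq.
eapply spec_step; [exact: dup|lia|rewrite !cats0].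
eapply spec_le; first eapply spec_eq; first exact: (@spec_guess_loop m 0).
  by rewrite addn0.
by nia.
Qed.

End GuessSpecs.

(** * Elimination *)

Definition skip_row :=
  transfer isbit 2 5 ;; sw 2 (fun o => if o is Some g then pop 2 ;; push 5 g else skip).

Definition copy_symbol :=
  sw 2 (fun o => if o is Some g then pop 2 ;; push 5 g ;; push 7 g else skip).

(** Copies to stack 6 the row whose index is in unary on stack 9, if there is one. *)
Definition select :=
  loop 9 isSome (pop 9 ;; skip_row) ;;
  loop 2 (oapp isbit false) copy_symbol ;; copy_symbol ;; move_all 5 2 ;; move_all 7 6.

Definition flip (g : sym) : sym :=
  match g with
  | Some (Some b) => bit (~~ b)
  | Some None => par
  | None => sep
  end.

(** The end mark [par] counts as a 1, so that one symbolwise addition handles coefficients and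
    right-hand side alike. *)
Definition add_symbol (g h : sym) : sym := if (g == one) || (g == par) then flip h else h.

Definition add_rest :=
  loop 6 isSome (sw 6 (fun o => if o is Some g then
      pop 6 ;; push 7 g ;; sw 2 (fun o' => if o' is Some h then pop 2 ;; push 5 (add_symbol g h) else skip)
    else skip)).

(** Below the initial zeros of the pivot an addition would change nothing, so both rows advance
    together to its leading one, where the symbol of the row decides. A pivot that is zero or absent
    shows no one there, and the row passes unchanged. *)
Definition eliminate_row :=
  loop 6 (pred1 (Some (bit false))) (pop 6 ;; push 7 (bit false) ;;
    sw 2 (fun o => if o is Some g then pop 2 ;; push 5 g else skip)) ;;
  sw 6 (fun o => if o == Some one then sw 2 (fun o' => if o' == Some one then add_rest else skip_row)
                 else skip_row) ;;
  move_all 7 6.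

Definition eliminate := loop 2 isSome eliminate_row ;; move_all 5 2 ;; discard predT 6.

(** The idle index selects no row and leaves stack 6 empty. *)
Definition pivot_code (rs : seq bool_row) j :=
  if j < size rs then row_code (nth ([::], false) rs j) else [::].

Lemma size_catrev (T : Type) (s t : seq T) : size (catrev s t) = size s + size t.
Proof. by rewrite catrevE size_cat size_rev. Qed.

Lemma row_codeE a b : row_code (a, b) = [seq bit x | x <- a] ++ [:: end_mark b].
Proof. by rewrite /row_code -cats1. Qed.

Lemma add_end_mark b b' : add_symbol (end_mark b) (end_mark b') = end_mark (b (+) b').
Proof. by case: b b' => [] []. Qed.

Lemma add_bit b b' : add_symbol (bit b) (bit b') = bit (b (+) b').
Proof. by case: b b' => [] []. Qed.

Section SelectSpecs.
Variable bs : nat -> bool.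
Local Notation spec := (spec bs).

Lemma spec_skip_row r X V R W M R' P Q D J U F c :
  spec skip_row c [:: X; V; row_code r ++ R; W; M; R'; P; Q; D; J; U; F] c
    (Some [:: X; V; R; W; M; catrev (row_code r) R'; P; Q; D; J; U; F]) (5 * size r.1 + 5).
Proof.
case: r => a b; rewrite row_codeE -catA /=.
eapply spec_step; first apply: (@spec_transfer _ isbit 2 5 _ _ [seq bit x | x <- a] (end_mark b :: R)) => //.
- by apply/allP=> _ /mapP [? _ ->].
- by case: b.
- by rewrite size_map; lia.
compute_stacks; rewrite size_map. eapply spec_le; first eapply spec_eq.
- by run_code.
- by compute_stacks; rewrite catrev_catl.
by lia.
Qed.

Lemma spec_copy_bits a X V R W M R' P Q D J U F c : ~~ oapp isbit false (ohead R) ->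
  spec (loop 2 (oapp isbit false) copy_symbol) c
    [:: X; V; [seq bit x | x <- a] ++ R; W; M; R'; P; Q; D; J; U; F] c
    (Some [:: X; V; R; W; M; catrev [seq bit x | x <- a] R'; P; catrev [seq bit x | x <- a] Q; D; J; U; F])
    (7 * size a).+1.
Proof.
move=> stop; elim: a R' Q => [|b a IH] R' Q /=.
  by apply: (@spec_le _ _ _ _ _ _ 1) => //; exact: spec_loop_exit.
eapply spec_le.
  eapply spec_loop_step; [by []|by []|by rewrite /copy_symbol; run_code|].
  compute_stacks; exact: IH.
by lia.
Qed.

Lemma spec_select rs j v X V W M D U F c : all (fun r => size r.1 == v) rs ->
  spec select c [:: X; V; rows_code rs; W; M; [::]; [::]; [::]; D; nseq j one; U; F] c
    (Some [:: X; V; rows_code rs; W; M; [::]; pivot_code rs j; [::]; D; [::]; U; F])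
    ((5 * v + 8) * j + 5 * size (rows_code rs) + 12 * v + 20).
Proof.
move=> wrs.
have skipping j' rs' R' : all (fun r => size r.1 == v) rs' ->
    spec (loop 9 isSome (pop 9 ;; skip_row)) c
      [:: X; V; rows_code rs'; W; M; R'; [::]; [::]; D; nseq j' one; U; F] c
      (Some [:: X; V; rows_code (drop j' rs'); W; M; catrev (rows_code (take j' rs')) R'; [::]; [::]; D; [::]; U; F])
      ((5 * v + 8) * j').+1.
  elim: j' rs' R' => [|j' IH] rs' R'.
    by rewrite take0 drop0 => _; apply: (@spec_le _ _ _ _ _ _ 1) => //; exact: spec_loop_exit.
  case: rs' => [|r rs'].
    move=> _; eapply spec_le.
      eapply spec_loop_step; [by []|by []| |].
        eapply spec_seq; first exact: spec_pop.
        compute_stacks; eapply spec_seq.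
          by apply: (@spec_transfer _ isbit 2 5 _ _ [::] [::]).
        by run_code.
      by compute_stacks; exact: (IH [::]).
    by rewrite /=; lia.
  case/andP=> /eqP sr wrs'; eapply spec_le.
    eapply spec_loop_step; [by []|by []| |].
      eapply spec_seq; first exact: spec_pop.
      by compute_stacks; exact: spec_skip_row.
    compute_stacks; eapply spec_eq; first exact: IH.
    by rewrite [in RHS]/rows_code /= catrev_catl.
  by rewrite sr; lia.
have szr (s : seq sym) : size (catrev s [::]) = size s by rewrite catrevE cats0 size_rev.
have revrev (s : seq sym) : catrev (catrev s [::]) [::] = s by rewrite !catrevE !cats0 revK.
eapply spec_step; [exact: skipping|by lia|].
rewrite /pivot_code; case: ltnP => [lt|ge].
  have e : rows_code (drop j rs) = row_code (nth ([::], false) rs j) ++ rows_code (drop j.+1 rs).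
    by rewrite (drop_nth ([::], false) lt).
  have e2 : rows_code rs = rows_code (take j rs) ++ rows_code (drop j rs).
    by rewrite -{1}(cat_take_drop j rs) /rows_code map_cat flatten_cat.
  have szrs : size (rows_code rs) = size (rows_code (take j rs)) + size (rows_code (drop j rs)).
    by rewrite {1}e2 size_cat.
  rewrite {2}e2 e in szrs *; move: szrs.
  have : size (nth ([::], false) rs j).1 == v by apply: (allP wrs); apply: mem_nth.
  case: (nth _ _ _) => a b /= /eqP sa; rewrite row_codeE -catA size_cat size_map /= => szrs.
  eapply spec_step; first apply: (@spec_copy_bits a X V (end_mark b :: rows_code (drop j.+1 rs))).
  - by case: (b).
  - by lia.
  eapply spec_step; [by rewrite /copy_symbol; run_code|by lia|].
  compute_stacks.
  eapply spec_step; [exact: spec_move|by rewrite /= !size_catrev size_map /=; lia|].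
  compute_stacks; rewrite !size_catrev size_map.
  eapply spec_le; first eapply spec_eq; first exact: spec_move.
    by compute_stacks; rewrite !catrevE !cats0 !rev_cat !revK -!catA.
  rewrite /= size_catrev size_map /=; lia.
rewrite drop_oversize // take_oversize // [rows_code [::]]/=.
eapply spec_step; [by apply: spec_loop_exit|by lia|].
eapply spec_step; [by rewrite /copy_symbol; run_code|by lia|].
compute_stacks.
eapply spec_step; [exact: spec_move|by rewrite /= szr; lia|].
compute_stacks; rewrite revrev szr; eapply spec_le; first exact: spec_move.
by rewrite /=; lia.
Qed.

End SelectSpecs.

Lemma row_code_cat a1 a2 b : row_code (a1 ++ a2, b) = [seq bit x | x <- a1] ++ row_code (a2, b).
Proof. by rewrite !row_codeE map_cat catA. Qed.

Lemma add_row_code a a' b b' : size a = size a' ->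
  [seq add_symbol p.1 p.2 | p <- zip (row_code (a, b)) (row_code (a', b'))] =
  row_code (xorl a a', b (+) b').
Proof.
elim: a a' => [|x a IH] [|x' a'] //= e; first by rewrite /row_code /= add_end_mark.
by case: e => e; rewrite -[RHS]/(bit (x (+) x') :: row_code (xorl a a', b (+) b')) -IH // -add_bit.
Qed.

Lemma xorl_cat0 p u h u' : size h = p -> xorl (nseq p false ++ u) (h ++ u') = h ++ xorl u u'.
Proof. by move=> <-; rewrite /xorl; elim: h => //= x h ->. Qed.

Definition elim_rows (rs : seq bool_row) (j : nat) : seq bool_row :=
  [seq elim_row (nth ([::], false) rs j) r | r <- rs].

Lemma width_elim_rows v rs j : all (fun r : bool_row => size r.1 == v) rs ->
  all (fun r : bool_row => size r.1 == v) (elim_rows rs j).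
Proof.
move=> wrs; apply/allP=> _ /mapP [r rin ->]; have /eqP sr := allP wrs _ rin.
have [lt|ge] := ltnP j (size rs).
  by rewrite size_elim ?sr // (eqP (allP wrs _ (mem_nth _ lt))).
by rewrite nth_default // /elim_row /= sr.
Qed.

Lemma size_rows_code v rs : all (fun r : bool_row => size r.1 == v) rs ->
  size (rows_code rs) = v.+1 * size rs.
Proof.
elim: rs => [|r rs IH] /=; first by rewrite muln0.
case/andP=> /eqP sr /IH; rewrite /rows_code /= size_cat size_row_code sr => ->.
by rewrite mulnS.
Qed.

Section EliminateSpecs.
Variable bs : nat -> bool.
Local Notation spec := (spec bs).

Lemma spec_add_rest l h X V R W M R' Q D J U F c : size l = size h ->
  spec add_rest c [:: X; V; h ++ R; W; M; R'; l; Q; D; J; U; F] c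
    (Some [:: X; V; R; W; M; catrev [seq add_symbol p.1 p.2 | p <- zip l h] R'; [::]; catrev l Q; D; J; U; F])
    (9 * size l).+1.
Proof.
elim: l h R' Q => [|g l IH] [|g' h] R' Q //=; first by move=> _; exact: spec_loop_exit.
case=> e; eapply spec_le.
  eapply spec_loop_step; [by []|by []|by run_code|].
  compute_stacks; exact: IH.
by lia.
Qed.

Lemma spec_search n h l X V R W M R' Q D J U F c : size h = n -> ohead l != Some (bit false) ->
  spec (loop 6 (pred1 (Some (bit false))) (pop 6 ;; push 7 (bit false) ;;
    sw 2 (fun o => if o is Some g then pop 2 ;; push 5 g else skip))) c
    [:: X; V; h ++ R; W; M; R'; nseq n (bit false) ++ l; Q; D; J; U; F] c
    (Some [:: X; V; R; W; M; catrev h R'; l; nseq n (bit false) ++ Q; D; J; U; F])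
    (8 * n).+1.
Proof.
move=> + stop; elim: n h R' Q => [|n IH] [|g h] R' Q //=.
  by move=> _; exact: spec_loop_exit.
case=> e; eapply spec_le.
  eapply spec_loop_step; [by []|by []|by run_code|].
  compute_stacks; eapply spec_eq; first exact: IH.
  by rewrite nseq_swap.
by lia.
Qed.

Lemma spec_eliminate_row r r' X V R W M R' D J U F c : size r.1 = size r'.1 ->
  spec eliminate_row c
    [:: X; V; row_code r' ++ R; W; M; R'; row_code r; [::]; D; J; U; F] c
    (Some [:: X; V; R; W; M; catrev (row_code (elim_row r r')) R'; row_code r; [::]; D; J; U; F])
    (22 * size r.1 + 30).
Proof.
case: r r' => a b [a' b'] /= sa.
(* The position of the leading one, or the full width if the pivot is zero. *)
pose p := index true a; have lep : p <= size a by apply: index_size.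
have ea : a = nseq p false ++ drop p a.
  rewrite /p {sa}; elim: {p lep} a => [|[] a IH] //=.
  by rewrite {1}IH.
have ea' : a' = take p a' ++ drop p a' by rewrite cat_take_drop.
have sh : size (take p a') = p by apply: size_takel; rewrite -sa.
have sd : size (drop p a) = size (drop p a') by rewrite !size_drop sa.
set u := drop p a in ea sd *; set u' := drop p a' in ea' sd *; set h := take p a' in ea' sh *.
have e1 : row_code (a, b) = nseq p (bit false) ++ row_code (u, b).
  by rewrite {1}ea row_code_cat map_nseq.
have e2 : row_code (a', b') = [seq bit x | x <- h] ++ row_code (u', b').
  by rewrite {1}ea' row_code_cat.
have ex : xorl a a' = h ++ xorl u u' by rewrite {1}ea {1}ea' xorl_cat0.
have sau : size a = p + size u by rewrite {1}ea size_cat size_nseq.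
have topu : ohead (row_code (u, b)) = if true \in a then Some one else Some (end_mark b).
  rewrite /u /p {ea ea' sh sd u u' h e1 e2 ex sau lep}; elim: {p sa} a => //= x a IH.
  by case: x; rewrite ?inE //= drop0.
have topR : true \in a -> ohead (row_code (u', b') ++ R) = Some (bit (nth false a' p)).
  by move=> ta; rewrite /u' (drop_nth false) -?sa ?index_mem.
rewrite e2 -catA.
rewrite {1}e1; eapply spec_step; first apply: spec_search.
- by rewrite size_map.
- by rewrite topu; case: ifP => // _; case: (b).
- by rewrite sau; lia.
rewrite cats0.
have restore T : 5 * size a + 6 <= T ->
    spec (move_all 7 6) c
      [:: X; V; R; W; M; catrev (row_code (a', b')) R'; row_code (u, b); nseq p (bit false); D; J; U; F] c
      (Some [:: X; V; R; W; M; catrev (row_code (a', b')) R'; row_code (a, b); [::]; D; J; U; F]) T.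
  move=> le; eapply spec_le; first eapply spec_eq; first exact: spec_move.
    by compute_stacks; rewrite !catrevE rev_nseq e1.
  by rewrite /= size_nseq; lia.
have skip_rest T : 5 * size u' + 5 <= T ->
    spec skip_row c [:: X; V; row_code (u', b') ++ R; W; M; catrev [seq bit x | x <- h] R';
                     row_code (u, b); nseq p (bit false); D; J; U; F] c
      (Some [:: X; V; R; W; M; catrev (row_code (a', b')) R'; row_code (u, b); nseq p (bit false);
                D; J; U; F]) T.
  move=> le; eapply spec_le; first eapply spec_eq; first exact: spec_skip_row.
    by rewrite e2 catrev_catl.
  exact: le.
rewrite /elim_row /= -/p; case: ifP topu topR => /= ta topu topR; last first.
  eapply (spec_step (T1 := (5 * size u' + 5).+1)); last first.
  - by apply: restore; lia.
  - by lia.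
  by apply: spec_sw => //; compute_stacks; rewrite topu (_ : (_ == _) = false); [apply: skip_rest|case: (b)].
case: ifP => nz.
  eapply (spec_step (T1 := (9 * (size u).+1).+3)).
  - apply: spec_sw => //; compute_stacks; rewrite topu eqxx.
    apply: spec_sw => //; compute_stacks.
    rewrite topR // nz eqxx.
    apply: (@spec_le _ _ _ _ _ _ (9 * size (row_code (u, b))).+1); last by rewrite size_row_code.
    by apply: spec_add_rest; rewrite !size_row_code /= sd.
  - by lia.
  rewrite add_row_code // /add_row /=; eapply spec_le; first eapply spec_eq; first exact: spec_move.
    compute_stacks; rewrite -catrev_catl -row_code_cat ex.
    by rewrite !catrevE rev_cat revK rev_nseq cats0 e1.
  by rewrite /= size_catrev size_row_code size_nseq /=; lia.
eapply (spec_step (T1 := (5 * size u' + 5).+2)); last first.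
- by apply: restore; lia.
- by lia.
apply: spec_sw => //; compute_stacks; rewrite topu eqxx.
apply: spec_sw => //; compute_stacks.
by rewrite topR // nz; apply: skip_rest.
Qed.

Lemma spec_eliminate_none r' X V R W M R' D J U F c :
  spec eliminate_row c
    [:: X; V; row_code r' ++ R; W; M; R'; [::]; [::]; D; J; U; F] c
    (Some [:: X; V; R; W; M; catrev (row_code r') R'; [::]; [::]; D; J; U; F])
    (22 * size r'.1 + 30).
Proof.
eapply spec_step; [by apply: spec_loop_exit|by lia|].
eapply spec_step.
- by apply: spec_sw => //; compute_stacks; exact: spec_skip_row.
- by lia.
by apply: (@spec_le _ _ _ _ _ _ 1); [apply: spec_loop_exit|lia].
Qed.

Lemma spec_eliminate rs j v X V W M D J U F c : all (fun r => size r.1 == v) rs ->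
  spec eliminate c [:: X; V; rows_code rs; W; M; [::]; pivot_code rs j; [::]; D; J; U; F] c
    (Some [:: X; V; rows_code (elim_rows rs j); W; M; [::]; [::]; [::]; D; J; U; F])
    ((22 * v + 31) * size rs + 5 * ((v.+1) * size rs) + 2 * v + 6).
Proof.
move=> wrs; rewrite /elim_rows; set r0 := nth _ rs j; set P := pivot_code rs j.
have sP : size P <= v.+1.
  rewrite /P /pivot_code; case: ifP => // lt; rewrite size_row_code ltnS.
  by have /eqP -> := allP wrs _ (mem_nth ([::], false) lt).
have one_row r R R' : r \in rs -> spec eliminate_row c
    [:: X; V; row_code r ++ R; W; M; R'; P; [::]; D; J; U; F] c
    (Some [:: X; V; R; W; M; catrev (row_code (elim_row r0 r)) R'; P; [::]; D; J; U; F])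
    (22 * v + 30).
  move=> rin; have /eqP sr := allP wrs _ rin.
  rewrite /P /pivot_code; case: ifP => lt.
    have /eqP s0 := allP wrs _ (mem_nth ([::], false) lt).
    by rewrite -[X in 22 * X]s0; apply: spec_eliminate_row; rewrite s0 sr.
  rewrite /r0 nth_default; last by rewrite leqNgt lt.
  by rewrite -sr; exact: spec_eliminate_none.
have all_rows (rs' : seq bool_row) R' : {subset rs' <= rs} -> spec (loop 2 isSome eliminate_row) c
    [:: X; V; rows_code rs'; W; M; R'; P; [::]; D; J; U; F] c
    (Some [:: X; V; [::]; W; M; catrev (rows_code [seq elim_row r0 r | r <- rs']) R'; P; [::]; D; J; U; F])
    ((22 * v + 31) * size rs').+1.
  elim: rs' R' => [|r rs' IH] R' sub.
    by apply: (@spec_le _ _ _ _ _ _ 1) => //; exact: spec_loop_exit.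
  eapply spec_le.
    eapply spec_loop_step; [by []|by case: (r) => [[]]|apply: one_row|].
      by apply: sub; rewrite inE eqxx.
    eapply spec_eq; first by apply: IH => x xin; apply: sub; rewrite inE xin orbT.
    by rewrite [in RHS]/rows_code /= catrev_catl.
  by rewrite /=; lia.
have srows := size_rows_code (width_elim_rows j wrs); rewrite size_map -/r0 in srows.
have szr (s : seq sym) : size (catrev s [::]) = size s by rewrite size_catrev addn0.
eapply spec_step; [by apply: all_rows|by lia|].
eapply spec_step; [exact: spec_move|by rewrite /= szr srows; lia|].
compute_stacks; rewrite szr srows !catrevE !cats0 revK.
eapply spec_le; first apply: (@spec_discard _ predT 6 _ _ P [::]) => //.
- by rewrite cats0.
- by apply/allP.
by lia.
Qed.

(** The parameter letters drive the rounds and are kept on stack 11, for the comparison with k at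
    the end. *)
Definition round := pop 0 ;; push 11 par ;; guess ;; select ;; eliminate.

Fixpoint guesses m k c :=
  if k is k'.+1 then guessed m (choices bs c (guess_length m)) :: guesses m k' (c + guess_length m)
  else [::].

Lemma spec_rounds k i N v rs V W c : all (fun r : bool_row => size r.1 == v) rs ->
  v <= N -> size rs <= N ->
  spec (loop 0 (pred1 (Some par)) round) c
    [:: nseq k par; V; rows_code rs; W; nseq (size rs) one; [::]; [::]; [::]; [::]; [::]; [::]; nseq i par]
    (c + k * guess_length (size rs))
    (Some [:: [::]; V; rows_code (foldl elim_rows rs (guesses (size rs) k c)); W; nseq (size rs) one;
              [::]; [::]; [::]; [::]; [::]; [::]; nseq (k + i) par])
    (100 * N.+1 ^ 2 * k).+1.
Proof.
move=> + leN; elim: k i rs c => [|k IH] i rs c wrs lemN.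
  by rewrite addn0; apply: (@spec_le _ _ _ _ _ _ 1) => //; exact: spec_loop_exit.
have lej : guessed (size rs) (choices bs c (guess_length (size rs))) <= size rs by apply: guessed_le.
have srs : size (elim_rows rs (guessed (size rs) (choices bs c (guess_length (size rs))))) = size rs.
  by rewrite size_map.
rewrite mulSn addnA; eapply spec_le.
  eapply spec_loop_step; [by []|by []| |].
    rewrite /round; eapply spec_seq; first exact: spec_pop.
    eapply spec_seq; first exact: spec_push.
    compute_stacks; eapply spec_seq; first exact: spec_guess.
    eapply spec_seq; first exact: spec_select wrs.
    exact: spec_eliminate wrs.
  have := IH i.+1 _ (c + guess_length (size rs))
    (width_elim_rows (guessed (size rs) (choices bs c (guess_length (size rs)))) wrs); rewrite srs => IH'.
  by eapply spec_eq; [exact: IH'|rewrite addnS].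
rewrite (size_rows_code wrs); move: (guessed _ _) lej {srs} => j lej.
move: (size rs) lemN lej => m lem lej {IH wrs}.
have : (5 * v + 8) * j <= (5 * N + 8) * N by apply: leq_mul; lia.
have : v.+1 * m <= N.+1 * N by apply: leq_mul; lia.
have : (22 * v + 31) * m <= (22 * N + 31) * N by apply: leq_mul; lia.
have : m ^ 2 <= N ^ 2 by rewrite leq_exp2r.
by rewrite !expnS !expn0 !muln1; nia.
Qed.

End EliminateSpecs.

(** * Evaluation *)

Definition is_one (o : option sym) := o == Some one.

Definition majority (a b c : bool) := (a && b) || (c && (a (+) b)).

(** Binary numbers are written least significant bit first: 8 and 9 accumulate the
    weights of the satisfied and falsified trivial equations, 10 holds the carry. *)
Definition full_add i b :=
  sw i (fun a => pop i ;; sw 10 (fun c => pop 10 ;;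
    push 7 (bit (is_one a (+) b (+) is_one c)) ;; push 10 (bit (majority (is_one a) b (is_one c))))).

Definition add_weight i :=
  push 10 (bit false) ;;
  loop 3 (oapp isbit false) (sw 3 (fun o => pop 3 ;; full_add i (is_one o))) ;; pop 3 ;;
  loop i isSome (full_add i false) ;;
  sw 10 (fun o => pop 10 ;; (if is_one o then push 7 one else skip)) ;; move_all 7 i.

(** The symbol behind the initial zeros classifies the row: a bit means nontrivial, [sep] means 0 =
    0, and [par] means 0 = 1. *)
Definition evaluate_row :=
  discard (pred1 (bit false)) 2 ;;
  sw 2 (fun o => match o with
    | Some (Some (Some _)) => discard isbit 2 ;; pop 2 ;; discard isbit 3 ;; pop 3
    | Some (Some None) => pop 2 ;; add_weight 8
    | _ => pop 2 ;; add_weight 9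
    end).

(** Borrowing turns the low zeros into ones and the first one into a zero. At value 0 there is no
    such one, and the program rejects. *)
Definition decrement :=
  loop 8 (pred1 (Some (bit false))) (pop 8 ;; push 7 one) ;;
  sw 8 (fun o => if is_one o then pop 8 ;; push 8 (bit false) else fail) ;; move_all 7 8.

(** The last symbol pushed on stack 10 tells which number is larger. *)
Definition compare :=
  loop 8 isSome (sw 8 (fun a => pop 8 ;; sw 9 (fun b => pop 9 ;;
    (if is_one a == is_one b then skip else push 10 (bit (is_one b)))))) ;;
  loop 9 isSome (sw 9 (fun b => pop 9 ;; (if is_one b then push 10 one else skip))) ;;
  sw 10 (fun o => if is_one o then fail else skip).

Definition evaluate :=
  loop 2 isSome evaluate_row ;; loop 11 isSome (pop 11 ;; decrement) ;; compare.

(** * Arithmetic on lists of binary digits *)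

Fixpoint add_carry (p : seq bool) (c : bool) : seq bool :=
  match p with
  | a :: p' => (a (+) c) :: add_carry p' (a && c)
  | [::] => if c then [:: true] else [::]
  end.

Fixpoint add_bits (w p : seq bool) (c : bool) : seq bool :=
  if w is b :: w' then
    (head false p (+) b (+) c) :: add_bits w' (behead p) (majority (head false p) b c)
  else add_carry p c.

Fixpoint decr_bits (p : seq bool) : option (seq bool) :=
  match p with
  | true :: p' => Some (false :: p')
  | false :: p' => omap (cons true) (decr_bits p')
  | [::] => None
  end.

Lemma bits_value_add_carry p c : bits_value (add_carry p c) = bits_value p + c.
Proof. by elim: p c => [|a p IH] [] //=; rewrite IH; case: a => /=; lia. Qed.

Lemma bits_value_add w p c : bits_value (add_bits w p c) = bits_value w + bits_value p + c.
Proof.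
elim: w p c => [|b w IH] p c /=; first exact: bits_value_add_carry.
by rewrite IH; case: p => [|a p] /=; [case: b c => [] []|case: a b c => [] [] []] => /=; lia.
Qed.

Lemma size_add_bits w p c : size (add_bits w p c) <= size w + size p + 1.
Proof.
elim: w p c => [|b w IH] p c /=; last by have := IH (behead p) (majority (head false p) b c); rewrite size_behead; lia.
by elim: p c => [|a p IH] c /=; [case: c|have := IH (a && c); lia].
Qed.

Lemma bits_value_decr p : if decr_bits p is Some q then
  bits_value p = (bits_value q).+1 /\ size q = size p else bits_value p = 0.
Proof.
elim: p => //= -[] p; first by move=> _ /=; lia.
by case: (decr_bits p) => [q [e s]|e] /=; rewrite e ?s; split; lia.
Qed.

(** [f] is the verdict of the lower digits, true if they favour the second number. A difference at
    the current digit overrides it; equality keeps it. *)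
Lemma ltn_bits_value a p n (f : bool) : (bits_value (a :: p) < bits_value n + f) =
  (bits_value p < bits_value (behead n) + (if a == head false n then f else head false n)).
Proof. by case: n => [|[] n]; case: a f => [] [] /=; apply/idP/idP; lia. Qed.

Section EvaluateSpecs.
Variable bs : nat -> bool.
Local Notation spec := (spec bs).

Lemma is_one_bit b : is_one (Some (bit b)) = b.
Proof. by case: b. Qed.

Lemma is_one_head p : is_one (ohead [seq bit b | b <- p]) = head false p.
Proof. by case: p => [|b p] //=; rewrite is_one_bit. Qed.

Section AddWeight.
Variables (neg : bool) (X V R M R' P D S F : seq sym) (c : nat).
(** [neg] selects the accumulator, stack 8 or stack 9, so that one proof serves both. *)
Let st W Q acc C := [:: X; V; R; W; M; R'; P; Q; if neg then D else acc; if neg then acc else D; C ++ S; F].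

Lemma spec_full_add W Q p b cy : spec (full_add (8 + neg) b) c (st W Q [seq bit x | x <- p] [:: bit cy]) c
  (Some (st W (bit (head false p (+) b (+) cy) :: Q) [seq bit x | x <- behead p]
         [:: bit (majority (head false p) b cy)])) 8.
Proof.
rewrite /full_add /st; case: neg; rewrite /=.
  eapply spec_le; first by eapply spec_eq; [run_code|compute_stacks; rewrite is_one_head is_one_bit; case: p].
  by [].
eapply spec_le; first by eapply spec_eq; [run_code|compute_stacks; rewrite is_one_head is_one_bit; case: p].
by [].
Qed.

(** Once the weight is exhausted, the unread digits [p'] of the accumulator and a carry remain; by
    the last equation, propagating this carry completes the sum. *)
Lemma spec_add_loop w W Q p cy : ~~ oapp isbit false (ohead W) ->
  exists o p' cy', [/\ spec (loop 3 (oapp isbit false) (sw 3 (fun o => pop 3 ;; full_add (8 + neg) (is_one o)))) c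
      (st ([seq bit x | x <- w] ++ W) Q [seq bit x | x <- p] [:: bit cy]) c
      (Some (st W (catrev [seq bit x | x <- o] Q) [seq bit x | x <- p'] [:: bit cy'])) (11 * size w).+1,
    size o = size w, size p' <= size p & add_bits w p cy = o ++ add_carry p' cy'].
Proof.
move=> stop; elim: w Q p cy => [|b w IH] Q p cy.
  exists [::], p, cy; split=> //; apply: (@spec_le _ _ _ _ _ _ 1) => //.
  by apply: spec_loop_exit; rewrite // /st; case: neg.
have [o [p' [cy' [sp so sp' e]]]] := IH (bit (head false p (+) b (+) cy) :: Q) (behead p) (majority (head false p) b cy).
exists (head false p (+) b (+) cy :: o), p', cy'; split=> //=; last first.
- by rewrite e.
- by rewrite (leq_trans sp') // size_behead leq_pred.
- by rewrite so.
eapply spec_le.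
  eapply spec_loop_step; [by []|by rewrite /st; case: neg| |exact: sp].
  eapply spec_sw; first by [].
  eapply spec_seq; first exact: spec_pop.
  rewrite (_ : is_one _ = b); last exact: is_one_bit.
  by rewrite (_ : set _ _ _ = st ([seq bit x | x <- w] ++ W) Q [seq bit x | x <- p] [:: bit cy]); [exact: spec_full_add|rewrite /st; case: neg].
by lia.
Qed.

Lemma spec_carry_loop W Q p cy : exists o cy',
  [/\ spec (loop (8 + neg) isSome (full_add (8 + neg) false)) c (st W Q [seq bit x | x <- p] [:: bit cy]) c
      (Some (st W (catrev [seq bit x | x <- o] Q) [::] [:: bit cy'])) (10 * size p).+1,
    size o = size p & add_carry p cy = o ++ (if cy' then [:: true] else [::])].
Proof.
elim: p Q cy => [|a p IH] Q cy.
  exists [::], cy; split=> //; apply: (@spec_le _ _ _ _ _ _ 1) => //.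
  by apply: spec_loop_exit; rewrite // /st; case: neg.
have [o [cy' [sp so e]]] := IH (bit (a (+) false (+) cy) :: Q) (majority a false cy).
exists (a (+) cy :: o), cy'; split=> //=.
- eapply spec_le.
    eapply spec_loop_step; [by case: neg|by rewrite /st; case: neg|exact: (@spec_full_add W Q (a :: p) false cy)|].
    by rewrite addbF in sp *; exact: sp.
  by lia.
- by rewrite so.
- by rewrite -e /majority andbF addbF andbC.
Qed.

Lemma spec_add_weight w p W : spec (add_weight (8 + neg)) c
  (st (weight_code w ++ W) [::] [seq bit x | x <- p] [::]) c
  (Some (st W [::] [seq bit x | x <- add_bits w p false] [::])) (20 * (size w + size p) + 30).
Proof.
have [o1 [p1 [c1 [sp1 so1 sp1' e1]]]] := @spec_add_loop w (sep :: W) [::] p false isT.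
have [o2 [c2 [sp2 so2 e2]]] := @spec_carry_loop W (catrev [seq bit x | x <- o1] [::]) p1 c1.
rewrite /weight_code cat_rcons; eapply spec_step; [by apply: spec_push|by lia|].
rewrite (_ : set _ _ _ = st ([seq bit x | x <- w] ++ sep :: W) [::] [seq bit x | x <- p] [:: bit false]); last first.
  by rewrite /st; case: neg.
eapply spec_step; [exact: sp1|by lia|].
eapply spec_step; [by apply: spec_pop|by lia|].
rewrite (_ : set _ _ _ = st W (catrev [seq bit x | x <- o1] [::]) [seq bit x | x <- p1] [:: bit c1]); last first.
  by rewrite /st; case: neg.
eapply spec_step; [exact: sp2|by lia|].
rewrite e1 e2; set l := [seq bit x | x <- o1 ++ _].
have szl : size l <= size o1 + size o2 + 1 by rewrite size_map !size_cat; case: (c2) => /=; lia.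
eapply (spec_step (T1 := 4) (c1 := c) (s1 := st W (catrev l [::]) [::] [::])).
- apply: spec_sw => //; rewrite (_ : is_one _ = c2); last exact: is_one_bit.
  rewrite /l /st !map_cat !catrev_catl; by case: (c2) => /=; case: neg; (eapply spec_le; [run_code|]).

- by lia.
have l8 : 8 + neg <= naux by case: neg.
have n7 : 7 != 8 + neg by case: neg.
eapply spec_le; first eapply spec_eq; first exact: (spec_move _ _ _ l8 n7).
  by rewrite /st; case: neg; compute_stacks; rewrite !catrevE !cats0 revK.
by rewrite /get /st /= size_catrev /=; lia.
Qed.

End AddWeight.

Lemma split_index (a : seq bool) : a = nseq (index true a) false ++ drop (index true a) a.
Proof. by elim: a => [|[] a IH] //=; rewrite {1}IH. Qed.

Lemma spec_evaluate_row r w p n X V R W M R' P F c :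
  spec evaluate_row c
    [:: X; V; row_code r ++ R; weight_code w ++ W; M; R'; P; [::];
        [seq bit x | x <- p]; [seq bit x | x <- n]; [::]; F] c
    (Some [:: X; V; R; W; M; R'; P; [::];
        [seq bit x | x <- if (true \notin r.1) && ~~ r.2 then add_bits w p false else p];
        [seq bit x | x <- if (true \notin r.1) && r.2 then add_bits w n false else n]; [::]; F])
    (20 * (size w + size p + size n) + 4 * size r.1 + 50).
Proof.
case: r => a b; rewrite [fst _]/= [snd _]/=; pose i := index true a; have lei : i <= size a by apply: index_size.
have e : row_code (a, b) ++ R = nseq i (bit false) ++ row_code (drop i a, b) ++ R.
  by rewrite {1}(split_index a) row_code_cat map_nseq -catA.
rewrite e; have [ta|za] := boolP (true \in a); rewrite /=; last first.
  have -> : drop i a = [::] by apply: drop_oversize; rewrite leqNgt index_mem.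
  eapply spec_step; first apply: (@spec_discard _ (pred1 (bit false)) 2 _ _ (nseq i (bit false)) (end_mark b :: R)) => //.
  - by rewrite all_nseq /= orbT.
  - by case: (b).
  - by rewrite size_nseq; lia.
  rewrite size_nseq; case: b {e} => /=.
    eapply spec_le; first eapply spec_sw => //; first (compute_stacks; eapply spec_seq; first exact: spec_pop).
      by compute_stacks; exact: (@spec_add_weight true X V R M R' P _ [::] F c w n W).
    by lia.
  eapply spec_le; first eapply spec_sw => //; first (compute_stacks; eapply spec_seq; first exact: spec_pop).
    by compute_stacks; exact: (@spec_add_weight false X V R M R' P _ [::] F c w p W).
  by lia.
have ed : drop i a = true :: drop i.+1 a by rewrite (drop_nth false) ?index_mem // nth_index.
have sd : size (drop i a) = size a - i by rewrite size_drop.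
eapply spec_step; first apply: (@spec_discard _ (pred1 (bit false)) 2 _ _ (nseq i (bit false)) (row_code (drop i a, b) ++ R)) => //.
- by rewrite all_nseq /= orbT.
- by rewrite ed.
- by rewrite size_nseq; lia.
rewrite size_nseq; compute_stacks; rewrite row_codeE /weight_code cat_rcons -catA.
eapply spec_le; first eapply spec_sw => //; first (rewrite /get /= ed; compute_stacks).
  eapply spec_seq; first apply: (@spec_discard _ isbit 2 _ _ [seq bit x | x <- drop i a] (end_mark b :: R)) => //.
  - by rewrite /get /= ed.
  - by apply/allP=> _ /mapP [? _ ->].
  - by case: (b).
  eapply spec_seq; first exact: spec_pop.
  eapply spec_seq; first apply: (@spec_discard _ isbit 3 _ _ [seq bit x | x <- w] (sep :: W)) => //.
  - by apply/allP=> _ /mapP [? _ ->].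
  exact: spec_pop.
by rewrite !size_map sd; lia.
Qed.

Lemma average_cons r w E : average ((r, w) :: E) =
  ((if true \notin r.1 then signed r.2 w else 0) + average E)%R.
Proof. by rewrite /average big_cons /=; case: ifP; rewrite ?add0r. Qed.

(** The size hypotheses are an invariant: adding [w] lengthens an accumulator by at most
    [size w + 1], which is the length of the code of [w] that is used up. *)
Lemma spec_evaluate_rows rs ws N v p n X V M R' P F c :
  all (fun r : bool_row => size r.1 == v) rs -> size rs = size ws ->
  size p + size (weights_code ws) <= N -> size n + size (weights_code ws) <= N ->
  exists p' n', [/\ spec (loop 2 isSome evaluate_row) c
    [:: X; V; rows_code rs; weights_code ws; M; R'; P; [::];
        [seq bit x | x <- p]; [seq bit x | x <- n]; [::]; F] c
    (Some [:: X; V; [::]; [::]; M; R'; P; [::];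
        [seq bit x | x <- p']; [seq bit x | x <- n']; [::]; F])
    ((60 * N + 4 * v + 51) * size rs).+1, size p' <= N, size n' <= N &
    ((bits_value p')%:Z - (bits_value n')%:Z = (bits_value p)%:Z - (bits_value n)%:Z +
       average (zip rs [seq bits_value w | w <- ws]))%R].
Proof.
elim: rs ws p n => [|r rs IH] [|w ws] p n //=.
  move=> _ _ lep len; exists p, n; split.
  - by apply: (@spec_le _ _ _ _ _ _ 1) => //; exact: spec_loop_exit.
  - exact: leq_trans (leq_addr _ _) lep.
  - exact: leq_trans (leq_addr _ _) len.
  - by rewrite /average big_nil addr0.
case/andP=> /eqP sr wrs [srs].
have swc : size (weights_code (w :: ws)) = (size w).+1 + size (weights_code ws).
  by rewrite /weights_code /= size_cat size_weight_code.
rewrite swc => lep len.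
set p1 := if (true \notin r.1) && ~~ r.2 then add_bits w p false else p.
set n1 := if (true \notin r.1) && r.2 then add_bits w n false else n.
have [||p' [n' [sp lep' len' e]]] := IH ws p1 n1 wrs srs.
- by rewrite /p1; case: ifP => _; have := size_add_bits w p false; lia.
- by rewrite /n1; case: ifP => _; have := size_add_bits w n false; lia.
exists p', n'; split=> //.
  eapply spec_le.
    eapply spec_loop_step; [by []|by case: (r) => [[|x a] b]|exact: spec_evaluate_row|exact: sp].
  by rewrite sr; nia.
rewrite e average_cons /p1 /n1; case: (true \notin r.1) => /=; last by rewrite add0r.
by case: r.2; rewrite /= bits_value_add /signed; lia.
Qed.

Lemma spec_decrement p X V R W M R' P n C F c :
  spec decrement c [:: X; V; R; W; M; R'; P; [::]; [seq bit x | x <- p]; n; C; F] c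
    (omap (fun q => [:: X; V; R; W; M; R'; P; [::]; [seq bit x | x <- q]; n; C; F]) (decr_bits p))
    (10 * size p + 10).
Proof.
(* The default in [head true q] covers empty [q]: the loop also stops when the digits are
   exhausted. *)
have zeros i q T : spec (loop 8 (pred1 (Some (bit false))) (pop 8 ;; push 7 one)) c
    [:: X; V; R; W; M; R'; P; T; nseq i (bit false) ++ [seq bit x | x <- q]; n; C; F] c
    (if head true q then Some [:: X; V; R; W; M; R'; P; nseq i one ++ T; [seq bit x | x <- q]; n; C; F]
     else None) (4 * i).+1 \/ ~~ head true q.
  have [hq|] := boolP (head true q); last by right.
  left; elim: i T => [|i IH] T; first by apply: spec_loop_exit => //; case: q hq => [|[]].
  eapply spec_le.
    eapply spec_loop_step; [by []|by []|by run_code|].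
    by compute_stacks; eapply spec_eq; [exact: IH|rewrite nseq_swap].
  by lia.
pose i := index true p; have ep := split_index p; rewrite -/i in ep.
have lei : i <= size p by apply: index_size.
have hd : head true (drop i p).
  by rewrite /i; elim: (p) => [|[] q IH].
have ed : decr_bits p = if drop i p is _ :: q then Some (nseq i true ++ false :: q) else None.
  rewrite /i; elim: (p) => [|[] q IH] //=; rewrite IH.
  by case: (drop _ _).
have [|/negP //] := zeros i (drop i p) [::]; rewrite hd cats0 => sp.
have -> : [seq bit x | x <- p] = nseq i (bit false) ++ [seq bit x | x <- drop i p].
  by rewrite {1}ep map_cat map_nseq.
eapply spec_step; [exact: sp|by lia|].
rewrite ed; case: (drop i p) hd => [|[] q] //= _.
  apply: spec_stop; [apply: (@spec_sw _ _ _ _ _ _ _ 0) => //; exact: spec_fail|by lia].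
eapply spec_step; [eapply spec_sw => //; compute_stacks; run_code|by lia|].
compute_stacks; eapply spec_le; first eapply spec_eq; first exact: spec_move.
  by compute_stacks; rewrite catrevE rev_nseq map_cat map_nseq.
by rewrite /= size_nseq; lia.
Qed.

Lemma spec_decrements k p X V R W M R' P n C c :
  exists q, spec (loop 11 isSome (pop 11 ;; decrement)) c
    [:: X; V; R; W; M; R'; P; [::]; [seq bit x | x <- p]; n; C; nseq k par] c
    (if k <= bits_value p then
       Some [:: X; V; R; W; M; R'; P; [::]; [seq bit x | x <- q]; n; C; [::]] else None)
    ((10 * size p + 12) * k).+1 /\
    (k <= bits_value p -> bits_value q = bits_value p - k /\ size q = size p).
Proof.
elim: k p => [|k IH] p.
  exists p; rewrite subn0; split=> //; apply: (@spec_le _ _ _ _ _ _ 1) => //; exact: spec_loop_exit.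
have dec := bits_value_decr p; have sp := @spec_decrement p X V R W M R' P n C (nseq k par) c.
case e : (decr_bits p) sp dec => [q|] /= sp; last first.
  move=> z; exists [::]; rewrite z; split=> //; eapply spec_le.
    eapply spec_loop_fail; [by []|by []|].
    eapply spec_seq; first exact: spec_pop.
    exact: sp.
  by lia.
case=> -> sq; have [q' [sp' h]] := IH q; exists q'; rewrite ltnS subSS; split.
  eapply spec_le.
    eapply spec_loop_step; [by []|by []| |exact: sp'].
    eapply spec_seq; first exact: spec_pop.
    exact: sp.
  by rewrite sq; lia.
by move=> le; have [-> ->] := h le.
Qed.

Lemma spec_compare p n X V R W M R' P c :
  exists s, spec compare c
    [:: X; V; R; W; M; R'; P; [::]; [seq bit x | x <- p]; [seq bit x | x <- n]; [::]; [::]] c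
    (if bits_value n <= bits_value p then Some s else None) (10 * size p + 10 * size n + 10).
Proof.
have first_loop n1 C (f : bool) : is_one (ohead C) = f -> exists n2 C2,
  [/\ spec (loop 8 isSome (sw 8 (fun a => pop 8 ;; sw 9 (fun b => pop 9 ;;
        (if is_one a == is_one b then skip else push 10 (bit (is_one b))))))) c
      [:: X; V; R; W; M; R'; P; [::]; [seq bit x | x <- p]; [seq bit x | x <- n1]; C; [::]] c
      (Some [:: X; V; R; W; M; R'; P; [::]; [::]; [seq bit x | x <- n2]; C2; [::]])
      (7 * size p).+1, size n2 <= size n1 &
    (bits_value p < bits_value n1 + f) = (0 < bits_value n2 + is_one (ohead C2))].
  elim: p n1 C f => [|a p IH] n1 C f hf.
    by exists n1, C; split=> //; [exact: spec_loop_exit|rewrite hf].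
  pose b := head false n1.
  have [|n2 [C2 [sp le e]]] := IH (behead n1) (if a == b then C else bit b :: C) (if a == b then f else b).
    by case: eqP; rewrite // is_one_bit.
  exists n2, C2; split.
  - eapply spec_le.
      eapply spec_loop_step; [by []|by []| |exact: sp].
      apply: (@spec_sw _ _ _ _ _ _ _ 5) => //; compute_stacks.
      apply: (@spec_seq _ _ _ _ _ _ _ _ _ 1 4); first exact: spec_pop.
      compute_stacks; apply: spec_sw => //; compute_stacks.
      apply: (@spec_seq _ _ _ _ _ _ _ _ _ 1 2); first exact: spec_pop.
      rewrite is_one_head is_one_bit -/b; case: ifP => _.
        by eapply spec_le; [eapply spec_eq; [exact: spec_skip|case: (n1)]|].
      by eapply spec_eq; [exact: spec_push|case: (n1)].
    by rewrite /=; lia.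
  - by rewrite (leq_trans le) // size_behead leq_pred.
  - by rewrite -e ltn_bits_value.
(* A one among the remaining digits of the second number outweighs all earlier verdicts; zeros leave
   the verdict as it is. *)
have second_loop n1 C : exists C2, spec (loop 9 isSome (sw 9 (fun b => pop 9 ;; (if is_one b then push 10 one else skip)))) c
      [:: X; V; R; W; M; R'; P; [::]; [::]; [seq bit x | x <- n1]; C; [::]] c
      (Some [:: X; V; R; W; M; R'; P; [::]; [::]; [::]; C2; [::]])
      (5 * size n1).+1 /\ is_one (ohead C2) = (0 < bits_value n1 + is_one (ohead C)).
  elim: n1 C => [|b n1 IH] C.
    by exists C; split; [exact: spec_loop_exit|rewrite add0n; case: is_one].
  have [C2 [sp e]] := IH (nseq b one ++ C); exists C2; split.
    eapply spec_le.
      eapply spec_loop_step; [by []|by []| |exact: sp].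
      eapply spec_sw => //; compute_stacks; eapply spec_seq; first exact: spec_pop.
      by rewrite is_one_bit; exact: spec_push_if.
    by rewrite /=; lia.
  by rewrite e {sp e}; case: b => /=; case: is_one; lia.
have [n2 [C2 [sp1 le e1]]] := first_loop n [::] false erefl.
have [C3 [sp2 e2]] := second_loop n2 C2.
exists [:: X; V; R; W; M; R'; P; [::]; [::]; [::]; C3; [::]].
eapply spec_step; [exact: sp1|by lia|].
eapply spec_step; [exact: sp2|by lia|].
apply: (@spec_le _ _ _ _ _ _ 2); last by lia.
apply: spec_sw => //; compute_stacks; rewrite e2 -e1 addn0 ltnNge.
case: (_ <= _) => /=; first exact: spec_skip.
by apply: (@spec_le _ _ _ _ _ _ 0) => //; exact: spec_fail.
Qed.

End EvaluateSpecs.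

(** * The machine for MaxLinAA *)

(** For the empty word and k = 0 the time bound is 1, so this case must be rejected by the very
    first test, before any parsing. *)
Definition program :=
  sw 0 (fun o => if o is Some (Some _)
    then parse ;; loop 0 (pred1 (Some par)) round ;; evaluate else fail).

Definition accepting_choices (x : seq (option bool)) k (bs : nat -> bool) : bool :=
  if read_system x is Some (v, E) then
    (k%:Z <= average (foldl elim_step (with_values E) (guesses bs (size E) k 0)))%R
  else false.

(** Eliminations leave the weights alone, which is why the machine can keep them on a stack of their
    own. *)
Lemma foldl_elim_step js (rs : seq bool_row) vs : size rs = size vs ->
  foldl elim_step (zip rs vs) js = zip (foldl elim_rows rs js) vs.
Proof.
elim: js rs => //= j js IH rs e; rewrite -IH ?size_map //; congr foldl.
rewrite /elim_step /elim_rows unzip1_zip ?e //; move: (nth _ rs j) => r.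
by elim: rs vs e {IH} => [|r' rs IHr] [|w vs] //= [] e; rewrite IHr.
Qed.

Lemma guesses_surj m js c : all (geq m) js -> exists bl, forall bs,
  (forall i, i < size bl -> bs (c + i) = nth false bl i) -> guesses bs m (size js) c = js.
Proof.
elim: js c => [|j js IH] c /=; first by exists [::].
case/andP=> lej /(IH (c + guess_length m)) [bl2 h2]; have [bl1 s1 g1] := guessed_surj lej.
exists (bl1 ++ bl2) => bs h; rewrite size_cat s1 in h.
have -> : choices bs c (guess_length m) = bl1.
  apply: (@eq_from_nth _ false); rewrite size_mkseq // => i lt.
  by rewrite nth_mkseq // h ?ltn_addr // nth_cat s1 lt.
rewrite g1 h2 // => i lt; rewrite -addnA h ?ltn_add2l // nth_cat s1 ltnNge leq_addr /=.
by rewrite addKn.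
Qed.

Lemma size_encode_eqns v E : all (wf_eqn v) E ->
  size (encode_eqns v E) >= v + 1 + 3 * size E + size (weights_code (unzip2 E)).
Proof.
move=> wE; rewrite /encode_eqns size_cat size_nseq /=.
suff : 3 * size E + size (weights_code (unzip2 E)) <= size (flatten [seq encode_eqn e | e <- E]) by lia.
elim: E {wE} => //= e E IH; rewrite /weights_code /= 2!size_cat size_encode_eqn size_weight_code.
by rewrite -/(unzip2 E) -/(weights_code _); lia.
Qed.

Lemma spec_program bs x k : exists c s,
  spec bs program 0 [:: instance_word x k] c
    (if accepting_choices x k bs then Some s else None) (k.+1 * (size x).+1 ^ 11) /\
  c <= k.+1 * trunc_log 2 (size x).
Proof.
have init o c T : spec bs program 0 [:: instance_word x k; [::]; [::]; [::]; [::]; [::]; [::]; [::]; [::]; [::]; [::]; [::]] c o T ->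
    spec bs program 0 [:: instance_word x k] c o T.
  by apply: spec_congr => //; do 13?[case=> //].
rewrite /accepting_choices; have [x0|x0] := posnP (size x).
  exists 0, [::]; split=> //; case: x x0 {init} => // _.
  have -> : read_system [::] = None by [].
  apply: (@spec_le _ _ _ _ _ _ 1); last by rewrite /= exp1n muln1.
  apply: spec_sw => //; rewrite /instance_word /get /=.
  by case: k => [|k] /=; exact: spec_fail.
have topx : exists a, ohead (instance_word x k) = Some (Some a).
  by case: x x0 {init} => //= a x _; exists a.
(* Origin of the exponent 11: the running time is quadratic, and as [(size x).+1] is at least 2,
   nine further powers give at least 512 and absorb the constant 300. *)
have bound T : T <= 300 * k.+1 * (size x).+1 ^ 2 -> T <= k.+1 * (size x).+1 ^ 11.
  move/leq_trans; apply; rewrite [300 * _]mulnC -mulnA leq_pmul2l // (expnD _ 2 9) mulnC leq_mul //.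
  by apply: (@leq_trans (2 ^ 9)); rewrite // leq_exp2r.
set n := size x in x0 bound *.
case: topx => a topx; have sp0 := @spec_parse bs x k 0; rewrite -/n in sp0.
case e: (read_system x) sp0 => [[v E]|] /= sp0; last first.
  exists 0, [::]; split=> //; apply/init/(spec_le _ (bound _ _)).
    eapply spec_sw => //; rewrite /get topx; apply: spec_stop; [exact: sp0|exact: leqnn].
  by nia.
have [ex wE] := (read_systemP x v E).1 e.
have := size_encode_eqns wE; rewrite -ex -/n => szx.
pose rs := unzip1 E; pose ws := unzip2 E; have srs : size rs = size E by rewrite size_map.
have wrs : all (fun r : bool_row => size r.1 == v) rs.
  by apply/allP=> _ /mapP [d /(allP wE) /and3P [sd _ _] ->].
have lev : v <= n by lia.
have lem : size rs <= n by rewrite srs; lia.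
have sp1 := @spec_rounds bs k 0 n v rs (nseq v one) (weights_code ws) 0 wrs lev lem.
rewrite srs in sp1; set gs := guesses bs _ k 0 in sp1 *.
have wfold : all (fun r : bool_row => size r.1 == v) (foldl elim_rows rs gs).
  by elim: (gs) (rs) wrs => //= j js IH rs' wrs'; apply: IH; apply: width_elim_rows.
have sfold : size (foldl elim_rows rs gs) = size E.
  by rewrite -srs; elim: (gs) (rs) => //= j js IH rs'; rewrite IH size_map.
have sws : size E = size ws by rewrite size_map.
have sww : size (weights_code ws) <= n by rewrite /ws; lia.
pose c1 := 0 + k * guess_length (size E).
have [p [q [sp2 lep leq e2]]] := @spec_evaluate_rows bs (foldl elim_rows rs gs) ws n v [::] [::] [::]
  (nseq v one) (nseq (size E) one) [::] [::] (nseq (k + 0) par) c1 wfold (etrans sfold sws) sww sww.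
have av : average (foldl elim_step (with_values E) gs) = ((bits_value p)%:Z - (bits_value q)%:Z)%R.
  have -> : with_values E = zip rs [seq bits_value w | w <- ws].
    by rewrite /rs /ws; elim: (E) => //= d E' ->.
  by rewrite foldl_elim_step ?size_map // e2 subrr add0r.
rewrite addn0 in sp1 sp2.
have [p' [sp3 val3]] := @spec_decrements bs k p [::] (nseq v one) [::] [::] (nseq (size E) one) [::] [::]
  [seq bit b | b <- q] [::] c1.
have [s sp4] := @spec_compare bs p' q [::] (nseq v one) [::] [::] (nseq (size E) one) [::] [::] c1.
pose fin := [:: [::]; nseq v one; [::]; [::]; nseq (size E) one; [::]; [::]; [::];
  [seq bit b | b <- p]; [seq bit b | b <- q]; [::]; nseq k par].
(* With p and q the satisfied and falsified weights, k <= p - q is tested without negative numbers,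
   as k <= p followed by q <= p - k. *)
have tail : spec bs (loop 11 isSome (pop 11 ;; decrement) ;; compare) c1 fin c1
    (if (k%:Z <= (bits_value p)%:Z - (bits_value q)%:Z)%R then Some s else None)
    ((10 * n + 12) * k + 20 * n + 11).
  have le1 : ((10 * size p + 12) * k).+1 <= ((10 * n + 12) * k).+1 by rewrite ltnS leq_mul; lia.
  case: leqP sp3 val3 => [lek sp3 /(_ isT) [vp' sp']|ltk sp3 _].
    eapply spec_le; first eapply spec_seq; first exact: sp3.
      eapply spec_eq; first exact: sp4.
      by rewrite vp'; congr (if _ then _ else _); apply/idP/idP; lia.
    by lia.
  have -> : (k%:Z <= (bits_value p)%:Z - (bits_value q)%:Z)%R = false by apply/idP/idP; lia.
  by apply: spec_stop; [exact: sp3|lia].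
exists c1, s; split; last first.
  rewrite /c1 add0n; apply: leq_mul => //.
  (* Doubling the number of equations accounts for the additive one in the length of a guess. *)
  have : 2 * size E <= n by lia.
  rewrite /guess_length; case: (size E) => // m le2.
  by rewrite -trunc_log2_double // -mul2n leq_trunc_log.
apply/init/(spec_le _ (bound _ _)).
  eapply spec_sw => //; rewrite /get topx.
  eapply spec_seq; first exact: sp0.
  eapply spec_seq; first exact: sp1.
  eapply spec_seq; first exact: sp2.
  by rewrite av; exact: tail.
have : (60 * n + 4 * v + 51) * size (foldl elim_rows rs gs) <= (60 * n + 4 * n + 51) * n.
  by apply: leq_mul; rewrite ?sfold; lia.
by rewrite !expnS !expn0 !muln1; nia.
Qed.

Lemma accepting_choicesP x k : (exists bs, accepting_choices x k bs) <-> MaxLinAA x k.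
Proof.
rewrite MaxLinAAP /accepting_choices; split=> [[bs]|[v [E [ex wE [z sz le]]]]].
  case e: (read_system x) => [[v E]|] // le.
  have [ex wE] := (read_systemP x v E).1 e; exists v, E; split=> //.
  have wv : has_width v (with_values E).
    by apply/allP=> _ /mapP [d /(allP wE) /and3P [sd _ _] ->].
  have [z sz lez] := elim_steps_sound (guesses bs (size E) k 0) wv.
  by exists z => //; apply: le_trans lez.
have e := (read_systemP x v E).2 (conj ex wE).
have wv : has_width v (with_values E).
  by apply/allP=> _ /mapP [d /(allP wE) /and3P [sd _ _] ->].
(* No left-hand side is zero at the start, so the deficit is at most k, the number of rounds. *)
have av0 : average (with_values E) = 0%R.
  rewrite /average big_map; apply: big1_seq => d /andP [/= nz /(allP wE)].
  by case/and3P=> _ tin _; rewrite tin in nz.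
have [|js [sj aj lej]] := @elim_steps_complete v (with_values E) z k k wv le.
  by rewrite av0 add0r.
rewrite size_map in aj; have [bl h] := guesses_surj 0 aj.
by exists (nth false bl); rewrite e -sj h ?sj.
Qed.

Theorem theorem3 : W_P MaxLinAA.
Proof.
exists (machine program), succn, 11; split; first exact: computable_succ.
move=> x k; have := machine_correct (fun bs => spec_program bs x k).
by case=> bounds acc; split=> //; apply: (iff_trans acc); exact: accepting_choicesP.
Qed.
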